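(* For every fixed integer $d \geq 2$, we have $\alpha(n,d) = o(n)$ as $n \to \infty$; that is, $\lim_{n\to\infty} \alpha(n,d)/n = 0$.
   Context: A set of points in $\mathbb{R}^d$ is in general position if no $d+1$ of its points lie on a common hyperplane, and in almost general position if no $d+2$ of its points lie on a common hyperplane (a hyperplane is an affine subspace of dimension $d-1$). For positive integers $n,d$, $\alpha(n,d)$ denotes the maximum integer $k$ such that every set of $n$ points in $\mathbb{R}^d$ in almost general position contains a subset of $k$ points in general position. *)

(* Defs.v *)
From HB Require Import structures.
From mathcomp Require Import all_boot all_order all_algebra.
From mathcomp Require Import finmap.
From mathcomp Require Import all_classical all_reals all_analysis.

Set Implicit Arguments.
Unset Strict Implicit.
Unset Printing Implicit Defensive.

Import Order.TTheory GRing.Theory Num.Theory.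
Import numFieldNormedType.Exports.

Local Open Scope classical_set_scope.
Local Open Scope fset_scope.
Local Open Scope ring_scope.

Definition is_hyperplane (R : realType) (d : nat) (H : set 'rV[R]_d) : Prop :=
  exists (p : 'rV[R]_d) (V : {vspace 'rV[R]_d}),
    (\dim V).+1 = d /\ H = [set x | x - p \in V].

Definition no_cohyperplanar (R : realType) (d m : nat)
    (A : {fset 'rV[R]_d}) : Prop :=
  forall S : {fset 'rV[R]_d}, S `<=` A -> #|` S| = m ->
    ~ exists2 H : set 'rV[R]_d, is_hyperplane H & forall x, x \in S -> H x.

Definition general_position (R : realType) (d : nat)
    (A : {fset 'rV[R]_d}) : Prop := no_cohyperplanar d.+1 A.

Definition almost_general_position (R : realType) (d : nat)
    (A : {fset 'rV[R]_d}) : Prop := no_cohyperplanar d.+2 A.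

Definition guarantees (R : realType) (n d k : nat) : Prop :=
  forall A : {fset 'rV[R]_d}, #|` A| = n -> almost_general_position A ->
    exists B : {fset 'rV[R]_d},
      [/\ B `<=` A, #|` B| = k & general_position B].

(* Restricting to k <= n loses nothing: for d >= 1 there are n-point sets in
   almost general position (e.g. on the moment curve), and a k-point subset of
   an n-point set has k <= n.  The condition always holds for k = 0. *)
Definition alpha (R : realType) (n d : nat) : nat :=
  \max_(k < n.+1 | `[< guarantees R n d k >]) k.

(* Main.v *)
Require Import Defs.
From HB Require Import structures.
From mathcomp Require Import all_boot all_order all_algebra.
From mathcomp Require Import finmap.
From mathcomp Require Import all_classical all_reals all_analysis.
From mathcomp Require Import zify ring.

Set Implicit Arguments.
Unset Strict Implicit.
Unset Printing Implicit Defensive.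

Import Order.TTheory GRing.Theory Num.Theory.
Import numFieldNormedType.Exports.

(** Why the theorem holds.  Write [d = p.+1].  For every [e] and every large [n]
one constructs [n] points of R^d in almost general position all of whose
subsets in general position have at most [2 * n / e] points.

The points live first in a grid [m]^N with [N = 8 * d], where sums of points
make sense, and are moved to R^d by a generic linear map at the very end.  A
linear map preserves affine dependencies, so [d.+1] dependent grid points land
on a common hyperplane; a generic one creates no new coincidence, so [d.+2]
grid points whose vectors have rank at least [d.+1] do not
([generic_projection]).

Dependencies are abundant: take a curve t |-> v_0 + v_1 t + ... + v_p t^p with
vector coefficients.  Any [p.+2] of its points are affinely dependent, since
divided differences of order [p.+1] kill polynomials of degree [p].  Averaging
over all curves, a set [C] of positive density in the grid contains
c |[m]^N|^d such [p.+2]-tuples, for one fixed tuple of instants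
([curve_supersaturation]).  Moreover, a tuple of this kind is determined by any
[p.+1] of its entries.

The method of hypergraph containers turns this into strong information on the
sets without such tuples: they all lie in one of only exp(O(t log n)) sets of
density as small as desired, where n = m^N and t = n^(1/d) = m^8
([grid_containers]).

Now choose [q] points of the grid at random, with [q] of the order of [m ^ 9].  As [q]
is much larger than t log n, a union bound shows that no container captures
more than [q / e] of the chosen points.  On the other hand [q] is so small that
there are few [d.+2]-tuples of chosen points of rank at most [d]: removing one
point from each leaves at least [q / 2] points ([random_subset],
[card_low_rank]).  The generic image of what remains is the desired set: no
[d.+2] of its points share a hyperplane, while a subset in general position
comes from a set without dependent tuples on curves, hence lies in a container
and has at most [q / e] points. *)

(** * Hypergraph containers *)

Lemma card_cons_tuple (V : finType) (s : nat) (G : pred (seq V)) :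
  #|[set f : s.+1.-tuple V | G f]|
    = \sum_(v : V) #|[set f : s.-tuple V | G (v :: f)]|.
Proof.
transitivity (\sum_(f : s.+1.-tuple V | G f) 1).
  by rewrite sum1_card; apply: eq_card => f; rewrite !inE.
rewrite (reindex (fun p : V * s.-tuple V => [tuple of p.1 :: p.2])) /=; last first.
  exists (fun f => (thead f, [tuple of behead f])) => [[v f] _|f _] /=.
    by congr (_, _); apply: val_inj.
  by rewrite [RHS](tuple_eta f).
rewrite -(pair_big_dep xpredT (fun v (f : s.-tuple V) => G (v :: f)) (fun _ _ => 1)) /=.
apply: eq_bigr => v _; rewrite sum1_card.
by apply: eq_card => f; rewrite !inE.
Qed.

Lemma card_setE (T : finType) (P : pred T) : #|[set x | P x]| = \sum_x (P x : nat).
Proof. by rewrite -sum1dep_card big_mkcond; apply: eq_bigr => x _; case: (P x). Qed.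

(** The sets of at most [t] elements are the values of this function; indexing
them in this way makes it plain that there are at most [#|V|.+1 ^ t] of them. *)
Definition list_set (V : finType) (t : nat) (f : {ffun 'I_t -> option V}) : {set V} :=
  [set v | Some v \in codom f].

Lemma card_list_set (V : finType) t (f : {ffun 'I_t -> option V}) :
  #|list_set f| <= t.
Proof.
have injS : injective (@Some V) by move=> ? ? [->].
rewrite -(card_imset _ injS).
apply: (@leq_trans #|codom f|).
  by apply/subset_leq_card/fintype.subsetP => w /imsetP[v]; rewrite inE => vc ->.
by rewrite -[leqRHS](card_ord t) -(size_image f); apply: card_size.
Qed.

Lemma list_set_exists (V : finType) t (T : {set V}) :
  #|T| <= t -> exists f : {ffun 'I_t -> option V}, list_set f = T.
Proof.
move=> leTt; exists [ffun i : 'I_t => nth None (map Some (enum T)) i].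
apply/setP => v; rewrite inE; apply/codomP/idP => [[i]|vT].
  rewrite ffunE => e; have [ltiT|leTi] := ltnP i #|T|.
    by move: e; rewrite (nth_map v) -?cardE// => -[->]; rewrite -mem_enum mem_nth// -cardE.
  by rewrite nth_default// size_map -cardE in e.
have idx : index v (enum T) < #|T| by rewrite cardE index_mem mem_enum.
exists (Ordinal (leq_trans idx leTt)); rewrite ffunE /= (nth_map v) -?cardE//.
by rewrite nth_index// mem_enum.
Qed.

(** An [s]-uniform ordered hypergraph on [V] is a predicate on sequences, of which
only the values on sequences of length [s] matter.  A set avoiding [G] and
containing [T] also avoids the [s.-1]-uniform hypergraph below. *)
Definition link (V : finType) (G : pred (seq V)) (T : {set V}) : pred (seq V) :=
  fun f => [exists v in T, G (v :: f)].

Definition independent (V : finType) (s : nat) (G : pred (seq V)) (A : {set V}) :=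
  forall f : s.-tuple V, G f -> ~~ all (mem A) f.

Definition codegree_le (V : finType) (s D : nat) (G : pred (seq V)) :=
  forall a b, (size a + size b).+1 = s -> #|[set x | G (a ++ x :: b)]| <= D.

Lemma codegree_link (V : finType) s D t (G : pred (seq V)) (T : {set V}) :
  codegree_le s.+1 D G -> #|T| <= t -> codegree_le s (D * t) (link G T).
Proof.
move=> cG leTt a b sab.
apply: (@leq_trans (\sum_(v in T) D)); last first.
  by rewrite sum_nat_const mulnC leq_mul2l leTt orbT.
apply: (@leq_trans (\sum_(v in T) #|[set x | G (v :: a ++ x :: b)]|)); last first.
  by apply: leq_sum => v _; apply: (cG (v :: a) b); rewrite /= addSn sab.
under eq_bigr do rewrite card_setE.
rewrite exchange_big card_setE /=; apply: leq_sum => x _.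
rewrite /link; case: existsP => //= -[v /andP[vT Gv]].
by rewrite (bigD1 v)//= Gv.
Qed.

Lemma independent_link (V : finType) s (G : pred (seq V)) (A T : {set V}) :
  independent s.+1 G A -> T \subset A -> independent s (link G T) A.
Proof.
move=> iG /fintype.subsetP TA f /existsP[v /andP[vT Gv]].
by have := iG [tuple of v :: f] Gv; rewrite /= TA.
Qed.

Lemma card_link_head (V : finType) s D (G : pred (seq V)) v :
  codegree_le s.+2 D G ->
  #|[set f : s.+1.-tuple V | G (v :: f)]| <= D * #|V| ^ s.
Proof.
move=> cG; rewrite (card_cons_tuple _ (fun f => G (v :: f))).
under eq_bigr do rewrite card_setE.
rewrite exchange_big /=.
apply: (@leq_trans (\sum_(f : s.-tuple V) D)); last by rewrite sum_nat_const card_tuple mulnC.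
apply: leq_sum => f _; rewrite -card_setE; apply: (cG [:: v] f).
by rewrite /= size_tuple.
Qed.

(** Containers, by induction on the uniformity.  Given a set [A] avoiding [G],
select greedily from [A] a set [T] of at most [t] vertices, each of which adds
many new edges to [link G T].  If [t] vertices are found, the link has many
edges.  Otherwise [A] lies in the set [CT T] of vertices that would add few
edges; either this set misses a good part of [C0] and is a container, or almost
all edges of [G] have their tail in the link, which again must then have many
edges.  Whenever the link has many edges, the induction hypothesis applies to it.
Only [T] has to be guessed, which bounds the number of containers.  Passing to
the link multiplies the codegree bound [D] by [t] and lowers [s] by one, which
preserves the relation [D * t ^ s = #|V|]; in the end [D = #|V|], so that the
edges, then single vertices, form a positive proportion of [V]. *)
Lemma hypergraph_containers (V : finType) (C0 : {set V}) (t s : nat) :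
  0 < t ->
  forall (D K : nat) (G : pred (seq V)), 0 < D -> 0 < #|V| ->
  D * t ^ s = #|V| ->
  (forall f : s.+1.-tuple V, G f -> all (mem C0) f) ->
  codegree_le s.+1 D G ->
  D * #|V| ^ s <= K * #|[set f : s.+1.-tuple V | G f]| ->
  exists F : {set {set V}},
  [/\ #|F| <= (2 * #|V|.+1 ^ t) ^ s,
      forall C, C \in F -> #|V| <= K * 4 ^ s * #|C0 :\: C|
    & forall A, independent s.+1 G A -> exists2 C, C \in F & A \subset C].
Proof.
move=> t0; elim: s => [|s IH] D K G D0 n0 Dt GC0 cG eG.
  exists [set ~: [set x | G [:: x]]]; split; first by rewrite cards1.
    move=> C /set1P ->; move: eG; rewrite -Dt !expn0 !muln1 => /leq_trans; apply.
    rewrite leq_mul2l; apply/orP; right.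
    rewrite card_cons_tuple; apply: (@leq_trans (\sum_(v in C0 :\: ~: [set x | G [:: x]]) 1)); last first.
      by rewrite sum1_card.
    rewrite [leqRHS]big_mkcond /=; apply: leq_sum => v _.
    have -> : [set f : 0.-tuple V | G (v :: f)] = [set f | G [:: v]].
      by apply/setP => f; rewrite !inE tuple0.
    rewrite !inE negbK; case: (boolP (G [:: v])) => Gv /=; last first.
      by have -> : [set f : 0.-tuple V | false] = finset.set0 by []; rewrite cards0.
    have -> : v \in C0 by have /= := GC0 [tuple v] Gv; rewrite andbT.
    by apply: leq_trans (max_card _) _; rewrite card_tuple.
  move=> A iA; exists (~: [set x | G [:: x]]); first exact/set1P.
  apply/fintype.subsetP => x xA; rewrite !inE; apply/negP => Gx.
  by have := iA [tuple x] Gx; rewrite /= xA.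
pose n := #|V|; rewrite -/n in n0 Dt eG IH *.
have Dtn : D * t <= n.
  by rewrite -Dt leq_mul2l -{1}[t]expn1 leq_pexp2l ?orbT.
pose gain (T : {set V}) v := #|[set f : s.+1.-tuple V | G (v :: f) & ~~ link G T f]|.
pose CT (T : {set V}) := [set v | 4 * K * gain T v < D * n ^ s].
pose eL (T : {set V}) := #|[set f : s.+1.-tuple V | link G T f]|.
have Dn0 : 0 < D * n ^ s by rewrite muln_gt0 D0 expn_gt0 n0.
have K0 : 0 < K.
  case: (posnP K) => // K0'; move: eG.
  by rewrite K0' mul0n leqn0 muln_eq0 expn_eq0 !eqn0Ngt D0 n0.
have CTC0 T : ~: CT T \subset C0.
  apply/fintype.subsetP => v; rewrite !inE -leqNgt => gv.
  have : 0 < gain T v.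
    rewrite lt0n; apply: contraL gv => /eqP ->.
    by rewrite muln0 -ltnNge.
  case/card_gt0P => f; rewrite inE => /andP[Gf _].
  by have /= /andP[] := GC0 [tuple of v :: f] Gf.
(* The heads of edges of G are split into those outside CT T, few in number;
   those whose edges are counted by the small gains; and those whose edges
   have a tail in the link, at most D for each tail. *)
have dich (T : {set V}) : 4 * K * #|C0 :\: CT T| < n -> D * t * n ^ s <= 4 * K * eL T.
  move=> small.
  have split3 : #|[set f : s.+2.-tuple V | G f]| <=
      #|C0 :\: CT T| * (D * n ^ s) + \sum_(v in CT T) gain T v + D * eL T.
    rewrite card_cons_tuple (bigID (mem (CT T))) /= addnC -addnA; apply: leq_add.
      rewrite -sum_nat_const.
      have -> : C0 :\: CT T = ~: CT T.
        by rewrite finset.setDE; apply/finset.setIidPr/CTC0.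
      rewrite [leqRHS](eq_bigl (fun i => i \notin CT T)); last by move=> i; rewrite !inE.
      by apply: leq_sum => v _; apply: card_link_head.
    apply: (@leq_trans (\sum_(v in CT T) (gain T v +
        #|[set f : s.+1.-tuple V | G (v :: f) & link G T f]|))).
      apply: leq_sum => v _; rewrite /gain !card_setE -big_split /=.
      by apply: leq_sum => f _; case: (G _); case: (link _ _ _).
    rewrite big_split /= leq_add2l.
    apply: (@leq_trans (\sum_v #|[set f : s.+1.-tuple V | G (v :: f) & link G T f]|)).
      by rewrite big_mkcond /=; apply: leq_sum => v _; case: ifP.
    under eq_bigr do rewrite card_setE.
    rewrite exchange_big /= /eL card_setE big_distrr /=; apply: leq_sum => f _.
    case: (link _ _ _) => /=; last by rewrite big1// => v _; rewrite andbF.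
    under eq_bigr do rewrite andbT.
    by rewrite -card_setE muln1; apply: (cG [::] f); rewrite /= size_tuple.
  have gains : 4 * K * \sum_(v in CT T) gain T v <= n * (D * n ^ s).
    rewrite big_distrr /=; apply: (@leq_trans (\sum_(v in CT T) (D * n ^ s))).
      by apply: leq_sum => v; rewrite inE => /ltnW.
    by rewrite sum_nat_const leq_mul2r max_card orbT.
  have p1 : 4 * K * #|C0 :\: CT T| * (D * n ^ s) <= n * (D * n ^ s).
    by rewrite leq_mul2r (ltnW small) orbT.
  have p2 := leq_mul (leqnn (4 * K)) split3.
  have p3 := leq_mul (leqnn 4) eG.
  have p4 : D * (n * n ^ s) <= D * (2 * K * eL T).
    rewrite expnS in p3.
    move: p1 p2 p3 gains.
    set a := #|C0 :\: CT T|; set b := \sum_(_ in _) _; set e := #|[set f | _]|.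
    set p := n ^ s; set l := eL T; nia.
  move: p4; rewrite leq_mul2l eqn0Ngt D0 /= => p4.
  have p5 : D * t * n ^ s <= n * n ^ s by rewrite leq_mul2r Dtn orbT.
  by apply: leq_trans (leq_trans p5 p4) _; rewrite -!mulnA leq_mul2r orbT.
have fam (f : {ffun 'I_t -> option V}) : exists F : {set {set V}},
    [/\ #|F| <= (2 * n.+1 ^ t) ^ s + 1,
      forall C, C \in F -> n <= K * 4 ^ s.+1 * #|C0 :\: C|
    & forall A, independent s.+2 G A -> list_set f \subset A ->
       (D * t * n ^ s <= 4 * K * eL (list_set f)) || (A \subset CT (list_set f)) ->
       exists2 C, C \in F & A \subset C].
  set T := list_set f.
  have leTt : #|T| <= t := card_list_set f.
  have [big|small] := boolP (D * t * n ^ s <= 4 * K * eL T).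
    have /= [] := IH (D * t) (4 * K) (link G T) _ n0 _ _ (codegree_link cG leTt) big.
    - by rewrite muln_gt0 D0.
    - by rewrite -mulnA -expnS.
    - move=> g /existsP[v /andP[vT Gv]].
      by have /= /andP[] := GC0 [tuple of v :: g] Gv.
    move=> F [F1 F2 F3]; exists F; split.
    - by rewrite (leq_trans F1) ?leq_addr.
    - move=> C /F2; rewrite expnS; congr (_ <= _); lia.
    - by move=> A iA TA _; apply: F3; apply: independent_link TA.
  exists [set CT T]; split => /=.
  - by rewrite cards1 leq_addl.
  - move=> C /set1P ->; rewrite leqNgt; apply/negP => lt; case/negP: small.
    apply: dich; apply: leq_ltn_trans lt; rewrite leq_mul2r expnS; apply/orP; right.
    by rewrite mulnC leq_mul2l leq_pmulr ?orbT// expn_gt0.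
  - by move=> A iA TA AT; exists (CT T) => //; apply/set1P.
have [F HF] := fin_all_exists fam.
exists (\bigcup_f F f); split.
- apply: (@leq_trans (\sum_(f : {ffun 'I_t -> option V}) ((2 * n.+1 ^ t) ^ s + 1))).
    elim/big_rec2: _ => [|f x X _ le]; first by rewrite cards0.
    apply: leq_trans (leq_card_setU _ _) _; apply: leq_add => //.
    by case: (HF f).
  rewrite sum_nat_const card_ffun card_option card_ord -/n expnS.
  have : 0 < (2 * n.+1 ^ t) ^ s by rewrite expn_gt0 muln_gt0 expn_gt0.
  set x := n.+1 ^ t; set y := _ ^ s; nia.
- by move=> C /bigcupP[f _]; case: (HF f) => _ + _; apply.
(* A greedy choice of T, as a set of maximal size among those all of whose
   elements contributed enough edges to the link. *)
move=> A iA.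
pose P (T : {set V}) := [&& T \subset A, #|T| <= t & #|T| * (D * n ^ s) <= 4 * K * eL T].
have P0 : P finset.set0 by rewrite /P finset.sub0set cards0 mul0n !leq0n.
case: (arg_maxnP (fun T : {set V} => #|T|) P0) => T /and3P[TA leTt PT] Tmax.
have [f fT] := list_set_exists leTt.
have [_ _ /(_ A iA)] := HF f; rewrite fT => /(_ TA) H.
suff /H [C CF AC] : (D * t * n ^ s <= 4 * K * eL T) || (A \subset CT T).
  by exists C => //; apply/bigcupP; exists f.
move: leTt; rewrite leq_eqVlt => /orP[/eqP eT|ltT].
  by rewrite -eT mulnAC mulnC PT.
apply/orP; right; apply/fintype.subsetP => v vA; rewrite inE ltnNge; apply/negP => gv.
have vT : v \notin T.
  apply/negP => vT; suff g0 : gain T v = 0 by move: gv; rewrite g0 muln0 leqNgt Dn0.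
  apply/eqP; rewrite cards_eq0; apply/eqP/setP => g; rewrite !inE.
  apply/negP => /andP[Gv /negP]; apply; apply/existsP; exists v; by rewrite vT.
have : P (v |: T).
  rewrite /P finset.subUset finset.sub1set vA TA cardsU1 vT /= add1n ltT /=.
  rewrite mulSn; apply: leq_trans (leq_add gv PT) _.
  rewrite -mulnDr leq_mul2l; apply/orP; right.
  rewrite /gain /eL !card_setE -big_split /=; apply: leq_sum => g _.
  case: (boolP (link G T g)) => /= [|nl].
    move=> /existsP[w /andP[wT Gw]]; rewrite andbF add0n.
    by rewrite (_ : link G (v |: T) g) //; apply/existsP; exists w; rewrite !inE wT orbT.
  rewrite andbT addn0; case: (boolP (G _)) => // Gv.
  by rewrite (_ : link G (v |: T) g) //; apply/existsP; exists v; rewrite !inE eqxx.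
by move/Tmax; rewrite cardsU1 vT /= add1n ltnn.
Qed.

(** * Polynomial curves in the grid *)

Definition grid (N m : nat) := {ffun 'I_N -> 'I_m}.

(** The initial point of a curve is stored shifted by [m], and so may have
coordinates between [- m] and [m]: in this way all grid points are reached by
equally many curves at each instant, without boundary effects. *)
Definition curve (N m r p : nat) : finType :=
  ({ffun 'I_N -> 'I_(2 * m)} * {ffun 'I_p -> {ffun 'I_N -> 'I_r}})%type.

(** The successors make the curves strictly increasing in each coordinate when
[0 < p], so that their points at distinct instants are distinct. *)
Definition curve_shift N r p (v : {ffun 'I_p -> {ffun 'I_N -> 'I_r}}) (i : 'I_N) (j : nat) : nat :=
  \sum_(k < p) (v k i).+1 * j ^ k.+1.

Definition curve_eval N m r p (q : curve N m r p) (i : 'I_N) (j : nat) : nat :=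
  q.1 i + curve_shift q.2 i j.

Definition hit N m r p (x : grid N m) (q : curve N m r p) (j : nat) : bool :=
  [forall i, (x i + m == curve_eval q i j)%N].

Definition curve_coef N m r p (q : curve N m r p) (i : 'I_N) (k : nat) : nat :=
  if k is k'.+1 then (if insub k' is Some o then (q.2 o i).+1 else 0) else q.1 i.

Lemma curve_eval_horner N m r p (q : curve N m r p) i j :
  ((\poly_(k < p.+1) ((curve_coef q i k)%:R : int)).[j%:R] = (curve_eval q i j)%:R)%R.
Proof.
rewrite horner_poly big_ord_recl /= expr0 mulr1 /curve_eval natrD; congr (_ + _)%R.
rewrite natr_sum; apply: eq_bigr => k _.
by rewrite /= valK natrM natrX.
Qed.

(** A nonzero polynomial of degree at most [p] has at most [p] roots. *)
Lemma curve_eval_inj N m r p (q q' : curve N m r p) (J : seq nat) :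
  uniq J -> p < size J ->
  (forall i j, j \in J -> curve_eval q i j = curve_eval q' i j) -> q = q'.
Proof.
move=> uJ sJ e.
have coefE i k : k <= p -> curve_coef q i k = curve_coef q' i k.
  move=> kp.
  pose P (q : curve N m r p) := (\poly_(k < p.+1) ((curve_coef q i k)%:R : int))%R.
  suff PP : P q = P q'.
    have := congr1 (fun P : {poly int} => P`_k)%R PP; rewrite !coef_poly ltnS kp => /eqP.
    by rewrite eqr_nat => /eqP.
  apply/eqP; rewrite -subr_eq0; apply/eqP.
  apply: (@roots_geq_poly_eq0 _ _ [seq (j%:R : int)%R | j <- J]).
  - apply/allP => _ /mapP[j jJ ->]; rewrite /root hornerD hornerN !curve_eval_horner.
    by rewrite e// subrr.
  - by rewrite map_inj_uniq// => a b /eqP; rewrite eqr_nat => /eqP.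
  - rewrite size_map; apply: leq_trans sJ.
    apply: leq_trans (size_polyD _ _) _.
    by rewrite size_polyN geq_max !size_poly.
case: q q' e coefE => [v0 v] [v0' v'] /= _ coefE; congr (_, _).
  by apply/ffunP => i; apply/val_inj; apply: (coefE i 0).
apply/ffunP => k; apply/ffunP => i; apply/val_inj.
have := coefE i k.+1 (ltn_ord k).
by rewrite /curve_coef /= valK => -[].
Qed.

Lemma curve_eval_mono N m r p (q : curve N m r p) i j j' :
  0 < p -> j < j' -> curve_eval q i j < curve_eval q i j'.
Proof.
case: p q => // p q _ lt; rewrite /curve_eval ltn_add2l /curve_shift !big_ord_recl.
rewrite -addSn leq_add//; first by rewrite ltn_mul2l /= ltn_exp2r.
by apply: leq_sum => k _; rewrite leq_mul2l leq_exp2r// (ltnW lt) orbT.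
Qed.

Lemma curve_shift_le N m r p M (v : {ffun 'I_p -> {ffun 'I_N -> 'I_r}}) i (j : nat) :
  p * r * M ^ p <= m -> j < M -> curve_shift v i j <= m.
Proof.
move=> pm jM; apply: leq_trans pm.
apply: (@leq_trans (\sum_(k < p) r * M ^ p)); last by rewrite sum_nat_const card_ord mulnA.
apply: leq_sum => k _; apply: leq_mul; first exact: ltn_ord.
have M0 : 0 < M by apply: leq_ltn_trans jM.
apply: leq_trans (leq_pexp2l M0 (ltn_ord k)).
by rewrite leq_exp2r// ltnW.
Qed.

Lemma card_grid N m : #|grid N m| = m ^ N.
Proof. by rewrite card_ffun !card_ord. Qed.

Lemma card_curve N m r p : #|curve N m r p| = (2 * m) ^ N * (r ^ N) ^ p.
Proof. by rewrite card_prod !card_ffun !card_ord. Qed.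

(** For every choice of the higher coefficients and every point of [C] there is
an initial point making the curve pass through it at instant [j]; the
hypothesis on [m] says that no curve moves by more than [m] before then. *)
Lemma card_hit N m r p M (C : {set grid N m}) (j : nat) :
  p * r * M ^ p <= m -> j < M ->
  #|C| * (r ^ N) ^ p <= #|[set q : curve N m r p | [exists x in C, hit x q j]]|.
Proof.
move=> pm jM.
pose Vt : finType := {ffun 'I_p -> {ffun 'I_N -> 'I_r}}.
have start (x : grid N m) (v : Vt) i : x i + m - curve_shift v i j < 2 * m.
  by have := ltn_ord (x i); lia.
pose F (xv : grid N m * Vt) : curve N m r p :=
  ([ffun i => Ordinal (start xv.1 xv.2 i)], xv.2).
have hitF xv : hit xv.1 (F xv) j.
  apply/forallP => i; rewrite /curve_eval /= ffunE /=.
  by rewrite subnK// (leq_trans (curve_shift_le xv.2 i pm jM))// leq_addl.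
have Finj : injective F.
  move=> [x v] [x' v'] e; have vv : v = v' by case: e.
  congr (_, _) => //; apply/ffunP => i; apply/val_inj/eqP.
  have /forallP/(_ i) := hitF (x, v); have /forallP/(_ i) := hitF (x', v').
  by rewrite -e /= => /eqP <-; rewrite eqn_add2r.
have -> : #|C| * (r ^ N) ^ p = #|finset.setX C [set: Vt]|.
  by rewrite cardsX cardsT !card_ffun !card_ord.
rewrite -(card_imset _ Finj); apply/subset_leq_card/fintype.subsetP => q /imsetP[[x v]].
rewrite !inE => /andP[xC _] ->; apply/existsP; exists x.
by rewrite xC (hitF (x, v)).
Qed.

(** The relation to which containers are applied: the points of [C] occupied by
one curve at the successive instants [J]. *)
Definition curve_tuple N m r p (C : {set grid N m}) (J : seq nat) (f : seq (grid N m)) : bool :=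
  all (mem C) f && [exists q : curve N m r p, all2 (fun x j => hit x q j) f J].

Lemma hit_inj N m r p (x x' : grid N m) (q : curve N m r p) j :
  hit x q j -> hit x' q j -> x = x'.
Proof.
move=> /forallP h /forallP h'; apply/ffunP => i; apply/val_inj/eqP.
by rewrite -(eqn_add2r m) (eqP (h i)) (eqP (h' i)).
Qed.

Lemma all2_cat_cons (S T : Type) (R : S -> T -> bool) a x b (J : seq T) :
  all2 R (a ++ x :: b) J -> exists J1 j J2, J = J1 ++ j :: J2 /\ [/\ size J1 = size a, all2 R a J1, R x j & all2 R b J2].
Proof.
elim: a J => [|y a IH] [|j J] //=.
  by move=> /andP[Rx Rb]; exists [::], j, J.
move=> /andP[Ry /IH[J1 [j' [J2 [-> [s Ra Rx Rb]]]]]].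
by exists (j :: J1), j', J2; rewrite /= s Ry.
Qed.

Lemma all2_hit_eval N m r p (q q' : curve N m r p) f J i j :
  all2 (fun x j => hit x q j) f J -> all2 (fun x j => hit x q' j) f J -> j \in J ->
  curve_eval q i j = curve_eval q' i j.
Proof.
elim: f J => [|x f IH] [|j' J] //= /andP[h a] /andP[h' a'].
rewrite inE => /orP[/eqP ->|]; last exact: IH.
by move: h h' => /forallP/(_ i)/eqP <- /forallP/(_ i)/eqP.
Qed.

Lemma curve_tuple_codegree N m r p (C : {set grid N m}) (J : seq nat) :
  uniq J -> size J = p.+2 -> codegree_le p.+2 1 (curve_tuple r p C J).
Proof.
move=> uJ sJ a b sab; rewrite leqNgt; apply/negP => /card_gt1P[x [y [+ + /eqP xy]]].
rewrite !inE => /andP[_ /existsP[q hq]] /andP[_ /existsP[q' hq']]; apply: xy.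
have [J1 [j [J2 [JE [s1 ha hx hb]]]]] := all2_cat_cons hq.
have [J1' [j' [J2' [JE' [s1' ha' hy hb']]]]] := all2_cat_cons hq'.
move: JE'; rewrite JE => /eqP; rewrite eqseq_cat ?s1 ?s1'//.
rewrite eqseq_cons => /and3P[/eqP E1 /eqP Ej /eqP E2]; subst J1' j' J2'.
suff qq : q = q' by rewrite -qq in hy; apply: hit_inj hx hy.
apply: (@curve_eval_inj _ _ _ _ _ _ (J1 ++ J2)).
- by move: uJ; rewrite JE; apply: subseq_uniq; apply: cat_subseq => //; apply: subseq_cons.
- by move: sJ; rewrite JE !size_cat /= addnS => -[->].
- move=> i k; rewrite mem_cat => /orP[] kJ.
    exact: all2_hit_eval ha ha' kJ.
  exact: all2_hit_eval hb hb' kJ.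
Qed.

Lemma curve_tuple_uniq N m r p (C : {set grid N m}) (J : seq nat) f :
  0 < N -> 0 < p -> uniq J -> curve_tuple r p C J f -> uniq f.
Proof.
move=> N0 p0 uJ /andP[_ /existsP[q]].
elim: f J uJ => [|x f IH] [|j J] //= /andP[jJ uJ] /andP[hx hf].
rewrite (IH J)// andbT; apply/negP => xf.
have [j' j'J hx'] : exists2 j', j' \in J & hit x q j'.
  elim: f J hf xf {IH jJ uJ} => [|y f IHf] [|j' J] //= /andP[hy hf].
  rewrite inE => /orP[/eqP ->|xf]; first by exists j'; rewrite ?inE ?eqxx.
  by have [k kJ hk] := IHf J hf xf; exists k; rewrite // inE kJ orbT.
have e : curve_eval q (Ordinal N0) j = curve_eval q (Ordinal N0) j'.
  by move: hx hx' => /forallP/(_ (Ordinal N0))/eqP <- /forallP/(_ (Ordinal N0))/eqP.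
case: (ltngtP j j') => [lt|lt|E]; last by rewrite E j'J in jJ.
  by have := curve_eval_mono q (Ordinal N0) p0 lt; rewrite e ltnn.
by have := curve_eval_mono q (Ordinal N0) p0 lt; rewrite e ltnn.
Qed.

(** An injection from [E] to [F] given by a relation rather than by a function. *)
Lemma leq_card_rel (S T : finType) (E : {set S}) (F : {set T}) (R : S -> T -> bool) :
  (forall x, x \in E -> exists2 y, y \in F & R x y) ->
  (forall x x' y, x \in E -> x' \in E -> R x y -> R x' y -> x = x') -> #|E| <= #|F|.
Proof.
move=> ex inj.
apply: (@leq_trans (\sum_(x in E) \sum_(y in F) R x y)).
  rewrite -sum1_card; apply: leq_sum => x /ex[y yF Rxy].
  by rewrite (bigD1 y)//= Rxy.
rewrite exchange_big /= -sum1_card; apply: leq_sum => y _.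
rewrite -big_mkcondr /= sum1_card; apply/card_le1_eqP => x x'.
move=> /andP[xE Rx] /andP[x'E Rx']; exact: (inj x' x y).
Qed.

(** A random curve meets [C] at [p.+2] instants at least on average, by the choice
of [M] (the factor [2 ^ N] compares the box of initial points with the grid).
Hence a proportion at least [1 / M] of all curves meets [C] that often, and some
tuple of [p.+2] instants is common to a proportion [1 / M ^ p.+2] of those. *)
Lemma curve_supersaturation N p k r m (C : {set grid N m}) :
  let M := k * 2 ^ N * p.+2 in
  0 < k -> 
  p * r * M ^ p <= m -> #|grid N m| <= k * #|C| ->
  exists J : p.+2.-tuple nat, uniq J /\
    #|grid N m| * (r ^ N) ^ p <=
       M ^ p.+3 * #|[set f : p.+2.-tuple (grid N m) | curve_tuple r p C J f]|.
Proof.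
move=> M k0 pm kC.
pose n := #|grid N m|; rewrite -/n in kC *.
pose a (q : curve N m r p) := [set j : 'I_M | [exists x in C, hit x q j]].
pose Q := [set q | p.+2 <= #|a q|].
have sum_a : M * (#|C| * (r ^ N) ^ p) <= \sum_q #|a q|.
  under eq_bigr do rewrite card_setE.
  rewrite exchange_big /= -{1}[M]card_ord -sum_nat_const; apply: leq_sum => j _.
  by rewrite -card_setE; apply: card_hit (ltn_ord j).
have sum_a' : \sum_q #|a q| <= p.+1 * #|curve N m r p| + M * #|Q|.
  have -> : p.+1 * #|curve N m r p| + M * #|Q| = \sum_q (p.+1 + (if q \in Q then M else 0)).
    by rewrite big_split /= -big_mkcond /= !sum_nat_const mulnC [M * _]mulnC.
  apply: leq_sum => q _; rewrite inE; case: ltnP => [_|h].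
    by rewrite (leq_trans _ (leq_addl _ _))//= (leq_trans (max_card _))// card_ord.
  by rewrite addn0.
have Qlarge : n * (r ^ N) ^ p <= M * #|Q|.
  move: (leq_trans sum_a sum_a'); rewrite card_curve expnMn -(card_grid N m) -/n.
  set R := (_ ^ p); set Z := 2 ^ N => h.
  have Z0 : 0 < Z by rewrite expn_gt0.
  have h2 : Z * p.+2 * (n * R) <= M * (#|C| * R).
    rewrite /M -/Z; have : Z * p.+2 * R * n <= Z * p.+2 * R * (k * #|C|) by rewrite leq_mul2l kC orbT.
    lia.
  have : n * R <= Z * (n * R) by rewrite leq_pmull.
  move: (leq_trans h2 h); set X := n * R.
  have -> : p.+1 * (Z * n * R) = p.+1 * (Z * X) by rewrite /X; lia.
  have -> : Z * p.+2 * X = p.+1 * (Z * X) + Z * X by rewrite -[p.+2]addn1; lia.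
  by rewrite leq_add2l => h3 h4; apply: leq_trans h4 h3.
pose E (J : p.+2.-tuple 'I_M) := [set q in Q | uniq J & all (mem (a q)) J].
have popular : #|Q| <= \sum_J #|E J|.
  under eq_bigr do rewrite card_setE.
  rewrite exchange_big /= -sum1_card big_mkcond /=; apply: leq_sum => q _.
  case: ifP => //; rewrite inE => qa.
  have sz : size (take p.+2 (enum (a q))) = p.+2.
    by rewrite size_take -cardE; case: ltnP => // h; apply/eqP; rewrite eqn_leq h qa.
  have st : size (take p.+2 (enum (a q))) == p.+2 by rewrite sz.
  rewrite (bigD1 (Tuple st)) //= take_uniq ?enum_uniq //=.
  have -> : all (mem (a q)) (take p.+2 (enum (a q))).
    by apply/allP => j /mem_take; rewrite mem_enum.
  by rewrite leq_addr.
have [J EJ] : exists J, #|Q| <= M ^ p.+2 * #|E J|.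
  have M0 : 0 < M by rewrite !muln_gt0 k0 expn_gt0.
  case: (@arg_maxnP _ [tuple of nseq p.+2 (Ordinal M0)] xpredT (fun J => #|E J|) isT) => J _ Jmax.
  exists J; apply: leq_trans popular _.
  apply: (@leq_trans (\sum_(J' : p.+2.-tuple 'I_M) #|E J|)); first by apply: leq_sum => J' _; apply: Jmax.
  by rewrite sum_nat_const card_tuple card_ord.
(* If J has repetitions then E J is empty, there are no curves at all, and any
   tuple will do. *)
have [uJ|nuJ] := boolP (uniq J); last first.
  exists (tcast (size_iota 0 p.+2) (in_tuple (iota 0 p.+2))); split.
    by rewrite val_tcast; exact: (iota_uniq 0 p.+2).
  have E0 : #|E J| = 0.
    by apply/eqP; rewrite cards_eq0; apply/eqP/setP => q; rewrite !inE (negPf nuJ) /= andbF.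
  by move: EJ Qlarge; rewrite E0 muln0 leqn0 => /eqP ->; rewrite muln0 leqn0 => /eqP ->.
exists [tuple of map val J]; split; first by rewrite map_inj_uniq//; apply: val_inj.
apply: leq_trans Qlarge _; rewrite (expnS _ p.+2) -mulnA leq_mul2l; apply/orP; right.
apply: leq_trans EJ _; rewrite leq_mul2l; apply/orP; right.
apply: (leq_card_rel (R := fun (q : curve N m r p) (f : p.+2.-tuple (grid N m)) =>
  all2 (fun x j => hit x q j) f (map val J))).
- move=> q; rewrite inE => /and3P[_ _ aJ].
  suff [f sf] : exists2 f, size f = size J & all (mem C) f && all2 (fun x j => hit x q j) f (map val J).
    move=> /andP[Cf hf]; have sf' : size f == p.+2 by rewrite sf size_tuple.
    exists (Tuple sf') => //=; rewrite inE /curve_tuple Cf /=.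
    by apply/existsP; exists q.
  elim: (tval J) aJ => [|j J' IH] /=; first by exists [::].
  rewrite inE => /andP[/existsP[x /andP[xC hx]]] /IH[f sf /andP[fC hf]].
  by exists (x :: f); rewrite /= ?sf// xC hx fC hf.
- move=> q q' f _ _ hq hq'; apply: (@curve_eval_inj _ _ _ _ _ _ (map val J)).
  + by rewrite map_inj_uniq//; apply: val_inj.
  + by rewrite size_map size_tuple ltnW.
  + by move=> i j; apply: all2_hit_eval hq hq'.
Qed.

(** * Containers of small density *)

Lemma card_bigcup_le (I V : finType) (E : {set I}) (F : I -> {set V}) X :
  (forall i, i \in E -> #|F i| <= X) -> #|\bigcup_(i in E) F i| <= #|E| * X.
Proof.
move=> FX; rewrite -sum_nat_const; elim/big_rec2: _ => [|i x S iE le]; first by rewrite cards0.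
by apply: leq_trans (leq_card_setU _ _) _; apply: leq_add => //; apply: FX.
Qed.

(** A container that is still large is refined by the containers relative to it,
each of which removes [#|V| / K] of its elements, so that [K.+1] rounds suffice. *)
Lemma iterate_containers (V : finType) (P : {set V} -> Prop) (small : pred {set V}) (K X : nat) :
  0 < #|V| -> 0 < X ->
  (forall C : {set V}, ~~ small C -> exists F : {set {set V}},
    [/\ #|F| <= X, forall C', C' \in F -> #|V| <= K * #|C :\: C'|
      & forall A, P A -> A \subset C -> exists2 C', C' \in F & A \subset C']) ->
  exists F : {set {set V}},
    [/\ #|F| <= X ^ K.+1, forall C, C \in F -> small C
      & forall A, P A -> exists2 C, C \in F & A \subset C].
Proof.
move=> V0 X0 step.
have step' (C : {set V}) : exists F : {set {set V}},
    [/\ #|F| <= X, forall C', C' \in F -> small C' || (#|V| + K * #|C'| <= K * #|C|)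
      & forall A, P A -> A \subset C -> exists2 C', C' \in F & A \subset C'].
  have [sC|/step[F [F1 F2 F3]]] := boolP (small C).
    exists [set C]; split; first by rewrite cards1.
      by move=> C' /set1P ->; rewrite sC.
    by move=> A _ AC; exists C; rewrite ?set11.
  exists [set C :&: C' | C' in F]; split.
  - by apply: leq_trans F1; apply: leq_imset_card.
  - move=> _ /imsetP[C' C'F ->]; apply/orP; right.
    by rewrite addnC -(cardsID C' C) mulnDr leq_add2l F2.
  - move=> A PA AC; have [C' C'F AC'] := F3 A PA AC.
    by exists (C :&: C'); [apply: imset_f | rewrite finset.subsetI AC].
have [G HG] := fin_all_exists step'.
suff iter i : exists F : {set {set V}},
    [/\ #|F| <= X ^ i, forall C, C \in F -> small C || (i * #|V| + K * #|C| <= K * #|V|)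
      & forall A, P A -> exists2 C, C \in F & A \subset C].
  have [F [F1 F2 F3]] := iter K.+1; exists F; split=> // C /F2 /orP[//|].
  by rewrite mulSn addnAC leqNgt -[ltnLHS]add0n ltn_add2r ltn_addr.
elim: i => [|i [F [F1 F2 F3]]].
  exists [set [set: _]]; split; first by rewrite cards1.
    by move=> C /set1P ->; rewrite mul0n add0n cardsT leqnn orbT.
  by move=> A _; exists [set: _]; rewrite ?set11 ?finset.subsetT.
exists (\bigcup_(C in F) if small C then [set C] else G C); split.
- rewrite expnS mulnC; apply: (@leq_trans (#|F| * X)); last by rewrite leq_mul2r F1 orbT.
  apply: card_bigcup_le => C _; case: ifP => _; first by rewrite cards1.
  by case: (HG C).
- move=> C' /bigcupP[C CF]; case: ifP => [sC /set1P -> |nsC C'G]; first by rewrite sC.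
  have [_ /(_ C' C'G)/orP[-> //|le] _] := HG C.
  have := F2 C CF; rewrite nsC /= mulSn => le2; apply/orP; right.
  by apply: leq_trans le2; rewrite addnAC addnC leq_add2l.
- move=> A PA; have [C CF AC] := F3 A PA.
  have [sC|nsC] := boolP (small C).
    by exists C => //; apply/bigcupP; exists C; rewrite ?sC ?set11.
  have [_ _ /(_ A PA AC)[C' C'G AC']] := HG C.
  by exists C' => //; apply/bigcupP; exists C; rewrite ?(negPf nsC).
Qed.

Definition curve_free N m r p (A : {set grid N m}) : Prop :=
  forall (J : seq nat) f, uniq J -> size J = p.+2 -> ~~ curve_tuple r p A J f.

(** The number of instants considered, for sets of density [1 / k]. *)
Definition times (N p k : nat) := k * 2 ^ N * p.+2.
(** With coefficients bounded by [r], no curve moves by more than [dilation N p k * r]. *)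
Definition dilation (N p k : nat) := p * times N p k ^ p.
Definition contconst (N p k : nat) :=
  dilation N p k ^ (N * p) * times N p k ^ p.+3 * 4 ^ p.+1.

(** The exponent [t] is the root of order [p.+1] of the size of the grid, as needed
to apply [hypergraph_containers] to a relation in which each entry is determined
by the others. *)
Lemma grid_containers N p k r t (m := dilation N p k * r) :
  0 < k -> 0 < p -> 0 < r -> 0 < t -> t ^ p.+1 = #|grid N m| ->
  exists F : {set {set grid N m}},
    [/\ #|F| <= ((2 * #|grid N m|.+1 ^ t) ^ p.+1) ^ (contconst N p k).+1,
        forall C, C \in F -> k * #|C| < #|grid N m|
      & forall A, curve_free r p A -> exists2 C, C \in F & A \subset C].
Proof.
move=> k0 p0 r0 t0 tn.
have n0 : 0 < #|grid N m| by rewrite -tn expn_gt0 t0.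
apply: iterate_containers => //; first by rewrite expn_gt0 muln_gt0 expn_gt0.
move=> C; rewrite -leqNgt => kC.
have pm : p * r * times N p k ^ p <= m by rewrite /m /dilation mulnAC.
have [J [uJ HJ]] := curve_supersaturation k0 pm kC.
have size_J : size J = p.+2 by rewrite size_tuple.
have [] := @hypergraph_containers _ C t p.+1 t0 1 (dilation N p k ^ (N * p) * times N p k ^ p.+3)
  (curve_tuple r p C J) isT n0 _ _ (curve_tuple_codegree r C uJ size_J).
- by rewrite mul1n tn.
- by move=> f /andP[].
- rewrite mul1n expnS -mulnA; apply: leq_trans (leq_mul (leqnn _) HJ).
  rewrite mulnCA leq_mul2l; apply/orP; right.
  by rewrite card_grid -!expnM -expnMn.
move=> F [F1 F2 F3]; exists F; split => // A fA AC; apply: F3 => f /andP[_ Ef].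
by apply/negP => Af; have /negP := fA J f uJ size_J; apply; rewrite /curve_tuple Af.
Qed.

(** * Random subsets *)

Lemma card_ffun_family (I W : finType) (P : I -> {set W}) :
  #|[set f : {ffun I -> W} | [forall i, f i \in P i]]| = \prod_i #|P i|.
Proof.
transitivity #|family (fun i => mem (P i))|.
  by apply: eq_card => f; rewrite inE; apply/forallP/familyP.
by rewrite card_family foldrE big_image.
Qed.

(** The union bound over the [2 ^ q] possible sets of indices sent into [C]. *)
Lemma card_hitting (q : nat) (W : finType) (C : {set W}) (k a : nat) :
  0 < k -> k * #|C| <= #|W| ->
  k ^ a * #|[set f : {ffun 'I_q -> W} | a <= #|[set i | f i \in C]|]| <= 2 ^ q * #|W| ^ q.
Proof.
move=> k0 kC.
pose E (I : {set 'I_q}) := [set f : {ffun 'I_q -> W} | [forall i, f i \in if i \in I then C else [set: _]]].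
have HE (I : {set 'I_q}) : k ^ #|I| * #|E I| <= #|W| ^ q.
  rewrite /E (card_ffun_family (fun i => if i \in I then C else [set: _])).
  rewrite (eq_bigr (fun i => if i \in I then #|C| else #|W|)); last first.
    by move=> i _; case: ifP; rewrite ?cardsT.
  rewrite -prod_nat_const big_mkcond -big_split /= (_ : #|W| ^ q = \prod_(i < q) #|W|); last first.
    by rewrite prod_nat_const card_ord.
  by apply: leq_prod => i _; case: (i \in I) => //; rewrite mul1n.
apply: (@leq_trans (\sum_(I : {set 'I_q}) #|W| ^ q)); last first.
  rewrite sum_nat_const leq_mul2r; apply/orP; right.
  by have := card_powerset [set: 'I_q]; rewrite powersetT !cardsT card_ord => ->.
apply: (@leq_trans (\sum_(I : {set 'I_q} | a <= #|I|) k ^ a * #|E I|)).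
  rewrite -big_distrr /= leq_mul2l; apply/orP; right.
  under eq_bigr do rewrite card_setE.
  rewrite exchange_big card_setE /=; apply: leq_sum => f _.
  case: (leqP a) => //= h; rewrite (bigD1 [set i | f i \in C])//=.
  suff -> : [forall i, f i \in if i \in [set i | f i \in C] then C else [set: W]] by [].
  by apply/forallP => i; rewrite inE; case: ifP; rewrite ?inE.
rewrite big_mkcond /=; apply: leq_sum => I _; case: ifP => // aI.
apply: leq_trans (HE I); rewrite leq_mul2r; apply/orP; right.
exact: leq_pexp2l.
Qed.

Lemma card_restrict (q s : nat) (W : finType) (g : {ffun 'I_s -> 'I_q}) (B : {set {ffun 'I_s -> W}}) :
  injective g ->
  #|[set f : {ffun 'I_q -> W} | [ffun j => f (g j)] \in B]| * #|W| ^ s <= #|B| * #|W| ^ q.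
Proof.
move=> injg.
pose E (b : {ffun 'I_s -> W}) := [set f : {ffun 'I_q -> W} |
  [forall i, f i \in [set w | [forall j, (g j == i) ==> (w == b j)]]]].
have HE b : #|E b| * #|W| ^ s <= #|W| ^ q.
  rewrite /E (card_ffun_family (fun i => [set w | [forall j, (g j == i) ==> (w == b j)]])).
  have -> : #|W| ^ s = \prod_(i < q) if i \in codom g then #|W| else 1.
    by rewrite -big_mkcond /= prod_nat_const card_codom// card_ord.
  rewrite -big_split /= (_ : #|W| ^ q = \prod_(i < q) #|W|); last first.
    by rewrite prod_nat_const card_ord.
  apply: leq_prod => i _; case: ifP => [/codomP[j ->]|_]; last by rewrite muln1 max_card.
  rewrite -[leqRHS]mul1n leq_mul2r; apply/orP; right.
  apply: (@leq_trans #|[set b j]|); last by rewrite cards1.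
  by apply/subset_leq_card/fintype.subsetP => w; rewrite !inE => /forallP/(_ j); rewrite eqxx.
rewrite -[leqRHS]sum_nat_const.
apply: (@leq_trans (\sum_(b in B) #|E b| * #|W| ^ s)); last by apply: leq_sum => b _; apply: HE.
rewrite -big_distrl /= leq_mul2r; apply/orP; right.
under eq_bigr do rewrite card_setE.
rewrite exchange_big card_setE /=; apply: leq_sum => f _.
case: (boolP (_ \in B)) => // fB; rewrite (bigD1 [ffun j => f (g j)])//=.
suff -> : [forall i, f i \in [set w | [forall j, (g j == i) ==> (w == [ffun j => f (g j)] j)]]] by [].
by apply/forallP => i; rewrite inE; apply/forallP => j; apply/implyP => /eqP <-; rewrite ffunE.
Qed.

Definition injections s q := [set g : {ffun 'I_s -> 'I_q} | injectiveb g].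

Definition pattern_count s q (W : finType) (B : {set {ffun 'I_s -> W}}) (f : {ffun 'I_q -> W}) :=
  #|[set g in injections s q | [ffun j => f (g j)] \in B]|.

(** The expected number of copies of [B] among [q] random points is at most
[q ^ s * #|B| / #|W| ^ s]. *)
Lemma sum_pattern_count s q (W : finType) (B : {set {ffun 'I_s -> W}}) :
  (\sum_(f : {ffun 'I_q -> W}) pattern_count B f) * #|W| ^ s <= q ^ s * #|B| * #|W| ^ q.
Proof.
rewrite /pattern_count; under eq_bigr do rewrite card_setE.
rewrite exchange_big big_distrl /=.
have -> : q ^ s * #|B| * #|W| ^ q = \sum_(g : {ffun 'I_s -> 'I_q}) #|B| * #|W| ^ q.
  by rewrite sum_nat_const card_ffun !card_ord mulnA.
apply: leq_sum => g _; rewrite inE; case: (boolP (injectiveb g)) => [/injectiveP injg|_] /=; last first.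
  by rewrite big1// mul0n.
by rewrite -card_setE; apply: card_restrict.
Qed.

(** The deletion method, for a random function [f] from ['I_q] to [W].  The
expected number of pairs of equal values and that of tuples in [B] are at most
[q / 8] each, and with probability at least 3/4 no member of [F] contains too
many values.  So for some [f] the latter holds and there are at most [q / 2]
tuples of either kind; removing the first index of each leaves the set [S].
The density [16 ^ - e] of the containers beats the factors [2 ^ q] coming from the
choices of a container and of a set of indices. *)
Lemma random_subset (W : finType) (s q e : nat) (F : {set {set W}}) (B : {set {ffun 'I_s.+1 -> W}}) :
  0 < e -> e <= q -> 0 < #|W| ->
  (forall C, C \in F -> 16 ^ e * #|C| <= #|W|) ->
  4 * #|F| <= 2 ^ q ->
  8 * (q ^ s.+1 * #|B|) <= q * #|W| ^ s.+1 ->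
  8 * q <= #|W| ->
  exists S : {set W}, [/\ q <= 2 * #|S|,
    forall g : 'I_s.+1 -> W, injective g -> (forall i, g i \in S) -> [ffun i => g i] \notin B &
    forall C, C \in F -> e * #|S :&: C| <= q].
Proof.
move=> e0 eq0 W0 FC F4 HB Hq.
have q0 : 0 < q by apply: leq_trans eq0.
set n := #|W| in W0 FC HB Hq *.
(* Coincidences between two random points are treated as another forbidden
   pattern. *)
pose D := [set h : {ffun 'I_2 -> W} | h ord0 == h ord_max].
have cD : #|D| <= n.
  rewrite /n -cardsT; apply: (leq_card_rel (R := fun (h : {ffun 'I_2 -> W}) (w : W) => h ord0 == w)).
    by move=> h _; exists (h ord0); rewrite ?inE.
  move=> h h' w; rewrite !inE => /eqP h01 /eqP h01' /eqP hw /eqP hw'.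
  apply/ffunP => i; have [->|->] : i = ord0 \/ i = ord_max.
  - by case: i => [[|[|//]] Hi]; [left|right]; apply/val_inj.
  - by rewrite hw hw'.
  - by rewrite -h01 -h01' hw hw'.
pose a := q %/ e.
pose overfull (f : {ffun 'I_q -> W}) := [exists C in F, a < #|[set i | f i \in C]|].
have coverfull : 4 * #|[set f | overfull f]| <= n ^ q.
  have k_ge : 4 ^ q <= (16 ^ e) ^ a.+1.
    rewrite -expnM (_ : 16 = 4 ^ 2)// -expnM leq_exp2l//.
    by have := ltn_ceil q e0; rewrite -/a; lia.
  have cC C : C \in F -> 2 ^ q * #|[set f : {ffun 'I_q -> W} | a < #|[set i | f i \in C]|]| <= n ^ q.
    move=> CF; have k0 : 0 < 16 ^ e by rewrite expn_gt0.
    have := @card_hitting q W C (16 ^ e) a.+1 k0 (FC C CF); rewrite -/n.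
    set c := #|_| => h.
    have : 4 ^ q * c <= 2 ^ q * n ^ q by apply: leq_trans h; rewrite leq_mul2r k_ge orbT.
    by rewrite (_ : 4 = 2 * 2)// expnMn -mulnA leq_mul2l expn_eq0.
  rewrite -(leq_pmul2l (_ : 0 < 2 ^ q)) ?expn_gt0//.
  apply: (@leq_trans (4 * (#|F| * n ^ q))); last first.
    by rewrite mulnA leq_mul2r F4 orbT.
  rewrite mulnCA leq_mul2l /= -sum_nat_const.
  apply: (@leq_trans (\sum_(C in F) 2 ^ q * #|[set f : {ffun 'I_q -> W} | a < #|[set i | f i \in C]|]|)); last exact: leq_sum.
  rewrite -big_distrr leq_mul2l; apply/orP; right.
  under [leqRHS]eq_bigr do rewrite card_setE.
  rewrite exchange_big card_setE /=; apply: leq_sum => f _.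
  case: (boolP (overfull f)) => // /existsP[C /andP[CF h]].
  by rewrite (bigD1 C)//= h.
have sumB : 8 * (\sum_(f : {ffun 'I_q -> W}) pattern_count B f) <= q * n ^ q.
  rewrite -(leq_pmul2r (_ : 0 < n ^ s.+1)) ?expn_gt0 ?W0// -mulnA.
  apply: leq_trans (leq_mul (leqnn 8) (sum_pattern_count q B)) _.
  by rewrite -/n mulnA [leqRHS]mulnAC leq_mul2r HB orbT.
have sumD : 8 * (\sum_(f : {ffun 'I_q -> W}) pattern_count D f) <= q * n ^ q.
  rewrite -(leq_pmul2r (_ : 0 < n ^ 2)) ?expn_gt0 ?W0// -mulnA.
  apply: leq_trans (leq_mul (leqnn 8) (sum_pattern_count q D)) _.
  rewrite -/n mulnA [leqRHS]mulnAC leq_mul2r; apply/orP; right.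
  apply: (@leq_trans (8 * (q ^ 2 * n))); first by rewrite !leq_mul2l cD !orbT.
  by rewrite !expnS !expn0 !muln1; nia.
have [f good] : exists f : {ffun 'I_q -> W},
    ~~ overfull f && (2 * (pattern_count B f + pattern_count D f) <= q).
  apply/existsP; apply: contraT; rewrite negb_exists => /forallP all_bad.
  have : q * n ^ q <= \sum_(f : {ffun 'I_q -> W}) (2 * (pattern_count B f + pattern_count D f) + q * overfull f).
    rewrite mulnC -{1}[q]card_ord -card_ffun -sum_nat_const; apply: leq_sum => f _.
    have := all_bad f; rewrite negb_and negbK; case: (overfull f) => /= h; first by rewrite muln1 leq_addl.
    by rewrite muln0 addn0 ltnW// ltnNge.
  rewrite big_split /= -!big_distrr /= big_split /= -card_setE.
  have nq0 : 0 < q * n ^ q by rewrite muln_gt0 q0 expn_gt0 W0.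
  have : 4 * (q * #|[set f | overfull f]|) <= q * n ^ q by rewrite mulnCA leq_mul2l coverfull orbT.
  move: nq0 sumB sumD; clear.
  move: (q * n ^ q) (q * _) (\sum_f _) (\sum_f _) => Q b x y *; exfalso; lia.
move/andP: good => [noverfull Zle].
pose kill t (BB : {set {ffun 'I_t.+1 -> W}}) :=
  [set (g : {ffun 'I_t.+1 -> 'I_q}) ord0 | g in [set g in injections t.+1 q | [ffun j => f (g j)] \in BB]].
have ckill t BB : #|kill t BB| <= pattern_count BB f by apply: leq_imset_card.
pose I0 := ~: (kill s B :|: kill 1 D).
have injI0 : {in I0 &, injective f}.
  move=> i j iI jI fij; apply/eqP; apply: contraT => ij.
  move: iI; rewrite !inE negb_or => /andP[_ /negP]; case.
  pose g : {ffun 'I_2 -> 'I_q} := [ffun x => if x == ord0 then i else j].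
  apply/imsetP; exists g; last by rewrite ffunE eqxx.
  rewrite !inE !ffunE /= fij eqxx andbT; apply/injectiveP => x y; rewrite !ffunE.
  have o2 (z : 'I_2) : z != ord0 -> z = ord_max.
    by case: z => [[|[|//]] Hz] h //; apply/val_inj.
  case: eqP => [->|/eqP/o2 ->]; case: eqP => [->|/eqP/o2 ->] // e1.
    by rewrite e1 eqxx in ij.
  by rewrite e1 eqxx in ij.
exists (f @: I0); split.
- rewrite (card_in_imset injI0) -(leq_add2r (2 * #|~: I0|)) -mulnDr cardsC card_ord.
  rewrite finset.setCK [leqRHS]mul2n -addnn leq_add2l; apply: leq_trans Zle; rewrite leq_mul2l /=.
  by apply: leq_trans (leq_card_setU _ _) _; apply: leq_add; apply: ckill.
- move=> g injg gS; apply/negP => gB.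
  have /fin_all_exists[h Hh] : forall i, exists j : 'I_q, j \in I0 /\ g i = f j.
    by move=> i; have /imsetP[j jI ->] := gS i; exists j.
  have [h0 _] := Hh ord0; move: h0; rewrite !inE negb_or => /andP[/negP + _]; apply.
  apply/imsetP; exists [ffun i => h i]; last by rewrite ffunE.
  rewrite !inE; apply/andP; split.
    apply/injectiveP => x y; rewrite !ffunE => hxy; apply: injg.
    by rewrite (Hh x).2 (Hh y).2 hxy.
  suff -> : [ffun j => f ([ffun i => h i] j)] = [ffun i => g i] by [].
  by apply/ffunP => i; rewrite !ffunE (Hh i).2.
- move=> C CF; apply: (@leq_trans (e * a)); last by rewrite mulnC leq_trunc_div.
  rewrite leq_mul2l; apply/orP; right.
  move: noverfull; rewrite /overfull negb_exists => /forallP/(_ C); rewrite CF /= -leqNgt.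
  apply: leq_trans; apply: leq_trans (leq_imset_card f _).
  apply/subset_leq_card/fintype.subsetP => w; rewrite inE => /andP[/imsetP[i iI ->] fC].
  by apply: imset_f; rewrite inE.
Qed.

(** * Tuples of low rank *)

Definition grid_pt (F : numFieldType) N m (x : grid N m) : 'rV[F]_N := (\row_i (x i)%:R)%R.

Lemma grid_pt_inj (F : numFieldType) N m : injective (@grid_pt F N m).
Proof.
move=> x y /rowP e; apply/ffunP => i; apply/val_inj/eqP.
by have := e i; rewrite !mxE => /eqP; rewrite eqr_nat.
Qed.

(** Some [\rank U] coordinates determine the vectors of [U]. *)
Lemma card_grid_subspace (F : numFieldType) N m k (U : 'M[F]_(k, N)) :
  #|[set x : grid N m | (grid_pt F x <= U)%MS]| <= m ^ \rank U.
Proof.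
rewrite -mxrank_tr; set UT := (U^T)%R; set f := maxrankfun UT.
rewrite -card_grid -cardsT.
apply: (leq_card_rel (R := fun (x : grid N m) (h : grid (\rank UT) m) => [forall i, h i == x (f i)])).
  by move=> x _; exists [ffun i => x (f i)]; rewrite ?inE//; apply/forallP => i; rewrite ffunE.
move=> x y h; rewrite !inE => /submxP[a xa] /submxP[b yb] /forallP hx /forallP hy.
apply: (@grid_pt_inj F).
have /submxP[Q UQ] : (UT <= rowsub f UT)%MS by rewrite eq_maxrowsub.
have {}UQ : U = (colsub f U *m Q^T)%R.
  apply: trmx_inj; rewrite trmx_mul trmxK; apply: (etrans UQ).
  by congr (_ *m _)%R; apply/matrixP => i j; rewrite !mxE.
have colE (v : 'rV[F]_k) : (v *m U)%R = (colsub f (v *m U) *m Q^T)%R.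
  rewrite {1}UQ mulmxA; congr (_ *m _)%R; apply/matrixP => i j.
  by rewrite !mxE; apply: eq_bigr => l _; rewrite !mxE.
rewrite xa yb colE [RHS]colE -xa -yb; congr (_ *m _)%R.
by apply/matrixP => i j; rewrite !mxE -(eqP (hx j)) -(eqP (hy j)).
Qed.

Definition pts_mx (F : numFieldType) N m s (g : 'I_s -> grid N m) : 'M[F]_(s, N) :=
  (\matrix_i grid_pt F (g i))%R.

(** The rank is that of the vectors, not of their homogeneous coordinates: being at
most the latter, it defines a larger set of tuples to be avoided, and it is what
[generic_projection] needs. *)
Definition low_rank (F : numFieldType) N m s d : {set {ffun 'I_s -> grid N m}} :=
  [set g : {ffun 'I_s -> grid N m} | \rank (pts_mx F g) <= d].

(** Such a tuple has at most [d] entries that span the others.  There are at most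
[m ^ N] choices for each of the former and, by [card_grid_subspace], at most
[m ^ d] for each of the latter. *)
Lemma card_low_rank (F : numFieldType) N m s d :
  d <= N -> d <= s -> 0 < m ->
  #|low_rank F N m s d| <= 2 ^ s * ((m ^ N) ^ d * m ^ (d * (s - d))).
Proof.
move=> dN ds m0; pose e := s - d.
pose span (I : {set 'I_s}) (h : 'I_s -> grid N m) : 'M[F]_N := (\sum_(i in I) <<grid_pt F (h i)>>)%MS.
have rank_span I h : \rank (span I h) <= #|I|.
  rewrite /span -sum1_card; elim/big_rec2: _ => [|i x U iI le]; first by rewrite mxrank0.
  apply: leq_trans (mxrank_adds_leqif _ _) _; apply: leq_add => //.
  by rewrite mxrank_gen rank_leq_row.
pose E (I : {set 'I_s}) := [set g : {ffun 'I_s -> grid N m} | [forall i, (grid_pt F (g i) <= span I g)%MS]].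
have x0 : grid N m := [ffun _ => Ordinal m0].
pose restr (I : {set 'I_s}) (g : {ffun 'I_s -> grid N m}) : {ffun 'I_s -> grid N m} := [ffun i => if i \in I then g i else x0].
have spanE I g : span I (restr I g) = span I g.
  by apply: eq_bigr => i iI; rewrite ffunE iI.
have cE (I : {set 'I_s}) : #|I| <= d -> #|E I| <= (m ^ N) ^ d * m ^ (d * e).
  (* Tuples in E I are grouped by their entries in I, the other entries being
     replaced by the default point x0. *)
  move=> Id; rewrite -/e.
  pose H := [set h : {ffun 'I_s -> grid N m} | [forall i, h i \in if i \in I then [set: _] else [set x0]]].
  have cH : #|H| = (m ^ N) ^ #|I|.
    rewrite /H (card_ffun_family (fun i => if i \in I then [set: _] else [set x0])).
    rewrite -prod_nat_const [RHS]big_mkcond /=; apply: eq_bigr => i _.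
    by case: ifP; rewrite ?cards1 ?cardsT ?card_grid.
  pose fib (h : {ffun 'I_s -> grid N m}) := [set g : {ffun 'I_s -> grid N m} |
    [forall i, g i \in if i \in I then [set h i] else [set x | (grid_pt F x <= span I h)%MS]]].
  have cfib h : #|fib h| <= (m ^ d) ^ (s - #|I|).
    rewrite /fib (card_ffun_family (fun i => if i \in I then [set h i] else [set x | (grid_pt F x <= span I h)%MS])).
    have -> : s - #|I| = #|~: I| by rewrite [RHS]cardsCs finset.setCK card_ord.
    rewrite -prod_nat_const [leqRHS]big_mkcond /=; apply: leq_prod => i _.
    rewrite inE; case: ifP => _ /=; first by rewrite cards1.
    apply: leq_trans (card_grid_subspace _ _) _.
    by apply: leq_pexp2l => //; apply: leq_trans (rank_span _ _) Id.
  have : #|E I| <= \sum_(h in H) #|fib h|.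
    under eq_bigr do rewrite card_setE.
    rewrite exchange_big -sum1_card big_mkcond /=; apply: leq_sum => g _.
    case: ifP => //; rewrite inE => /forallP gE.
    rewrite (bigD1 (restr I g)) /=; last first.
      by rewrite inE; apply/forallP => i; rewrite ffunE; case: ifP; rewrite !inE.
    suff -> : [forall i, g i \in if i \in I then [set restr I g i] else
       [set x | (grid_pt F x <= span I (restr I g))%MS]] by [].
    by apply/forallP => i; case: ifP => iI; rewrite inE ?spanE ?gE// ffunE iI.
  move=> le; apply: leq_trans le _; apply: (@leq_trans (\sum_(h in H) (m ^ d) ^ (s - #|I|))); first exact: leq_sum.
  rewrite sum_nat_const cH.
  have -> : s - #|I| = (d - #|I|) + e by rewrite addnC addnBA// subnK.
  have -> : (m ^ N) ^ d = (m ^ N) ^ #|I| * (m ^ N) ^ (d - #|I|) by rewrite -expnD subnKC.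
  rewrite expnD -(expnM m d e) mulnA leq_mul2r leq_mul2l -!expnM.
  by rewrite leq_pexp2l ?leq_mul2r ?dN ?orbT.
apply: (@leq_trans #|\bigcup_(I in [set I : {set 'I_s} | #|I| <= d]) E I|).
  apply/subset_leq_card/fintype.subsetP => g; rewrite inE => gd.
  set f := maxrankfun (pts_mx F g).
  apply/bigcupP; exists [set f i | i in 'I_(\rank (pts_mx F g))].
    by rewrite inE (leq_trans (leq_imset_card _ _))// card_ord.
  rewrite inE; apply/forallP => i.
  have -> : grid_pt F (g i) = row i (pts_mx F g) by rewrite rowK.
  have sub : (pts_mx F g <= rowsub f (pts_mx F g))%MS by rewrite eq_maxrowsub.
  apply: submx_trans (row_sub _ _) _; apply: submx_trans sub _.
  apply/row_subP => j; apply: (sumsmx_sup (f j)); first exact: imset_f.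
  by rewrite row_rowsub rowK genmxE.
apply: leq_trans (card_bigcup_le (X := (m ^ N) ^ d * m ^ (d * (s - d))) _) _.
  by move=> I; rewrite inE; apply: cE.
rewrite leq_mul2r; apply/orP; right; apply: leq_trans (max_card _) _.
by have := card_powerset [set: 'I_s]; rewrite powersetT !cardsT card_ord => ->.
Qed.

(** * Generic projections *)

Local Open Scope ring_scope.

Lemma avoid_roots (F : numFieldType) (P : {poly F}) : P != 0 -> exists n : nat, P.[n%:R] != 0.
Proof.
move=> P0; have : ~~ all (root P) [seq (n%:R : F) | n <- iota 0 (size P)].
  apply/negP => allr; have := max_poly_roots P0 allr.
  rewrite map_inj_uniq ?iota_uniq; last by move=> a b /eqP; rewrite eqr_nat => /eqP.
  by rewrite size_map size_iota ltnn => /(_ isT).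
by case/allPn => _ /mapP[n _ ->] nr; exists n.
Qed.

(** A point of the moment curve, as its scalar product with each [z] is a nonzero
polynomial in the parameter. *)
Lemma generic_row (F : numFieldType) N (l : seq 'cV[F]_N) :
  (forall z, z \in l -> z != 0) -> exists w : 'rV[F]_N, forall z, z \in l -> w *m z != 0.
Proof.
move=> lN0; pose P (z : 'cV[F]_N) : {poly F} := \sum_(i < N) z i 0 *: 'X^i.
have Pc z (i : 'I_N) : (P z)`_i = z i 0.
  rewrite /P coef_sum (bigD1 i)//= coefZ coefXn eqxx mulr1 big1 ?addr0// => j ji.
  by rewrite coefZ coefXn eq_sym (inj_eq val_inj) (negPf ji) mulr0.
have P0 z : z \in l -> P z != 0.
  move=> /lN0; apply: contra => /eqP Pz; apply/eqP/colP => i.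
  by rewrite mxE -Pc Pz coef0.
have [n] : exists n : nat, (\prod_(z <- l) P z).[n%:R] != 0.
  apply: avoid_roots; rewrite prodf_seq_neq0; apply/allP => z zl; exact: P0.
rewrite horner_prod prodf_seq_neq0 => /allP Pn.
exists (\row_i n%:R ^+ i) => z zl; apply: contraNneq (Pn z zl) => wz.
have := congr1 (fun M : 'M[F]_(1, 1) => M 0 0) wz; rewrite !mxE => e.
rewrite /= -{}e /P horner_sum; apply/eqP/eq_bigr => i _.
by rewrite mxE hornerZ hornerXn mulrC.
Qed.

Definition one_row (F : numFieldType) s : 'rV[F]_s := const_mx 1.

(** The rows of [P] are chosen one at a time.  If [k] rows have been chosen for
[k < d], then the row space of the matrix of homogeneous coordinates of the
projected points has dimension [k.+1], hence does not contain all rows of the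
matrix of coordinates, of rank greater than [d].  So a generic combination of these
is outside of it. *)
Lemma generic_projection (F : numFieldType) N m s d k : (k <= d)%N ->
  exists P : 'M[F]_(k, N),
    (forall x y : grid N m, (0 < k)%N -> x != y -> P *m (grid_pt F x)^T != P *m (grid_pt F y)^T) /\
    (forall g : {ffun 'I_s.+1 -> grid N m}, (d < \rank (pts_mx F g))%N ->
       row_free (col_mx (one_row F s.+1) (P *m (pts_mx F g)^T))).
Proof.
elim: k => [|k IH] kd.
  exists 0; split=> // g _; rewrite -row_leq_rank.
  apply: leq_trans (mxrankS (_ : (one_row F s.+1 <= _)%MS)); last first.
    by rewrite -addsmxE addsmxSl.
  rewrite lt0n mxrank_eq0; apply/eqP => /rowP/(_ ord0)/eqP; by rewrite !mxE oner_eq0.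
have [P [_ Pg]] := IH (ltnW kd).
pose Y (g : {ffun 'I_s.+1 -> grid N m}) := col_mx (one_row F s.+1) (P *m (pts_mx F g)^T).
pose Z (g : {ffun 'I_s.+1 -> grid N m}) := (pts_mx F g)^T *m cokermx (Y g).
have Zcol (g : {ffun 'I_s.+1 -> grid N m}) : exists j, (d < \rank (pts_mx F g))%N ==> (col j (Z g) != 0).
  have [dg|_] := boolP (d < _)%N; last by exists ord0.
  suff : Z g != 0.
    move=> Zg; have [/existsP[j ?]|] := boolP [exists j, col j (Z g) != 0]; first by exists j.
    rewrite negb_exists => /forallP all0; case/eqP: Zg; apply/matrixP => i j.
    by have /negPn/eqP/colP/(_ i) := all0 j; rewrite !mxE.
  apply: contraTneq dg => Zg; rewrite -leqNgt.
  have : ((pts_mx F g)^T <= Y g)%MS by rewrite submxE; apply/eqP.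
  by move=> /mxrankS; rewrite mxrank_tr => /leq_trans; apply; apply: leq_trans (rank_leq_row _) _.
have [j Hj] := fin_all_exists Zcol.
pose l := [seq col (j g) (Z g) | g : {ffun 'I_s.+1 -> grid N m} <- enum {ffun 'I_s.+1 -> grid N m} & (d < \rank (pts_mx F g))%N] ++
  [seq (grid_pt F xy.1)^T - (grid_pt F xy.2)^T | xy <- enum {: grid N m * grid N m} & xy.1 != xy.2].
have [|w Hw] := @generic_row F N l.
  move=> z; rewrite mem_cat => /orP[] /mapP[g]; rewrite mem_filter => /andP[dg _] ->.
    exact: (implyP (Hj g)).
  by rewrite subr_eq0 (inj_eq (@trmx_inj _ _ _)) (inj_eq (@grid_pt_inj F N m)).
exists (col_mx w P : 'M[F]_(k.+1, N)); split.
  move=> x y _ xy; rewrite -subr_eq0 -mulmxBr.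
  have : w *m ((grid_pt F x)^T - (grid_pt F y)^T) != 0.
    apply: Hw; rewrite mem_cat; apply/orP; right; apply/mapP.
    by exists (x, y) => //; rewrite mem_filter /= xy mem_enum.
  set v := _ - _ => wv.
  have -> : (col_mx w P : 'M[F]_(k.+1, N)) *m v = col_mx (w *m v) (P *m v) by rewrite -mul_col_mx.
  by apply: contraNneq wv => /eqP; rewrite (col_mx_eq0 (w *m v)) => /andP[].
move=> g dg; have wY : ~~ (w *m (pts_mx F g)^T <= Y g)%MS.
  rewrite submxE -mulmxA -/(Z g).
  have : w *m col (j g) (Z g) != 0.
    apply: Hw; rewrite mem_cat; apply/orP; left; apply/mapP.
    by exists g => //; rewrite mem_filter dg mem_enum.
  by apply: contraNN => /eqP wZ; rewrite colE mulmxA wZ mul0mx.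
have lt : (\rank (Y g) < \rank (w *m (pts_mx F g)^T + Y g)%MS)%N.
  by apply: rank_ltmx; rewrite /ltmx addsmxSr addsmx_sub (negPf wY).
rewrite -row_leq_rank; apply: leq_trans (leq_trans lt (mxrankS _)).
  by rewrite ltnS row_leq_rank Pg.
have -> : (col_mx w P : 'M[F]_(k.+1, N)) *m (pts_mx F g)^T
    = col_mx (w *m (pts_mx F g)^T) (P *m (pts_mx F g)^T) by rewrite -mul_col_mx.
have sub1 : (one_row F s.+1 + (w *m (pts_mx F g)^T + P *m (pts_mx F g)^T) <=
   col_mx (one_row F s.+1) (col_mx (w *m (pts_mx F g)^T) (P *m (pts_mx F g)^T)))%MS.
  by rewrite addsmx_sub -!addsmxE addsmxSl (submx_trans _ (addsmxSr _ _))// addsmxE.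
apply: submx_trans sub1; rewrite addsmx_sub /Y; apply/andP; split.
  exact: submx_trans (addsmxSl _ _) (addsmxSr _ _).
rewrite -addsmxE addsmx_sub addsmxSl /=.
exact: submx_trans (addsmxSr _ _) (addsmxSr _ _).
Qed.

(** * Hyperplanes and the projected grid *)

(** The square matrix of homogeneous coordinates of the points is singular, so its
columns are dependent too: this dependency is the equation of a hyperplane. *)
Lemma dependent_in_hyperplane (R : realType) d (y : 'I_d.+1 -> 'rV[R]_d) (c : 'rV[R]_d.+1) :
  c != 0 -> (c *m const_mx 1 = (0 : 'M[_]_1)) -> c *m (\matrix_l y l) = 0 ->
  exists2 H : set 'rV[R]_d, is_hyperplane H & forall l, H (y l).
Proof.
move=> c0 c1 cy; pose M : 'M[R]_(d.+1, 1 + d) := row_mx (const_mx 1) (\matrix_l y l).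
have cM : c *m M = 0 by rewrite mul_mx_row c1 cy row_mx0.
have rM : (\rank M^T < 1 + d)%N.
  rewrite mxrank_tr ltn_neqAle rank_leq_col andbT; apply: contra c0 => /eqP rM.
  have fM : row_free M by rewrite /row_free rM.
  by apply/eqP/(row_free_inj fM); rewrite cM mul0mx.
have /rowV0Pn[u /sub_kermxP uM u0] : kermx M^T != 0.
  by rewrite kermx_eq0 /row_free neq_ltn rM.
pose phi := rsubmx (u : 'rV_(1 + d)); pose b := lsubmx (u : 'rV_(1 + d)).
have on_plane l : y l *m phi^T = - b.
  have : row l (M *m u^T) = 0 by rewrite -[M]trmxK -trmx_mul uM trmx0 row0.
  rewrite row_mul -[u]hsubmxK tr_row_mx row_row_mx mul_row_col row_const rowK -/phi -/b.
  have -> : const_mx 1 *m b^T = b.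
    by apply/matrixP => i j; rewrite !mxE big_ord1 !mxE mul1r !ord1.
  by move/eqP; rewrite addrC addr_eq0 => /eqP.
have phi0 : phi != 0.
  apply: contra u0 => /eqP p0; have := on_plane ord0; rewrite p0 trmx0 mulmx0.
  by move=> /eqP; rewrite eq_sym oppr_eq0 => /eqP b0; rewrite -[u]hsubmxK -/phi -/b p0 b0 row_mx0.
pose h : 'Hom('rV[R]_d, 'rV[R]_1) := linfun (mulmxr phi^T).
exists [set x | x - y ord0 \in lker h]%classic; last first.
  by move=> l /=; rewrite memv_ker lfunE /= mulmxBl !on_plane subrr.
exists (y ord0), (lker h); split=> //.
suff limg1 : (\dim (limg h) = 1)%N.
  by have := limg_ker_dim h fullv; rewrite capfv dimvf /dim /= mul1n limg1 addn1.
apply/eqP; rewrite eqn_leq; apply/andP; split.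
  by rewrite (leq_trans (dimvS (subvf _)))// dimvf /dim.
rewrite lt0n dimv_eq0; apply: contra phi0 => /eqP h0; apply/eqP/rowP => j.
have : h (delta_mx 0 j) = 0 by apply/eqP; rewrite -memv0 -h0 memv_img ?memvf.
rewrite lfunE /= -rowE => /rowP/(_ 0); by rewrite !mxE.
Qed.

Lemma hyperplane_functional (R : realType) d (H : set 'rV[R]_d) :
  is_hyperplane H -> exists (phi : 'rV[R]_d) (b : 'M[R]_1),
    phi != 0 /\ forall x, H x -> x *m phi^T = b.
Proof.
move=> [q [V [dV ->]]].
pose B : 'M[R]_(\dim V, d) := \matrix_i (vbasis V)`_i.
have rB : (\rank B^T < d)%N.
  by rewrite mxrank_tr; apply: leq_ltn_trans (rank_leq_row _) _; rewrite dV.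
have /rowV0Pn[phi /sub_kermxP phiB phi0] : kermx B^T != 0.
  by rewrite kermx_eq0 /row_free neq_ltn rB.
exists phi, (q *m phi^T); split=> // x /= xV.
apply/eqP; rewrite -subr_eq0 -mulmxBl; apply/eqP.
rewrite (coord_vbasis xV) mulmx_suml big1// => i _.
rewrite -scalemxAl (_ : _ *m _ = 0) ?scaler0//.
have -> : (vbasis V)`_i = row i B by rewrite rowK.
by rewrite -row_mul -[B]trmxK -trmx_mul phiB trmx0 row0.
Qed.

(** The rows of a Vandermonde matrix with more rows than columns are dependent, and
the coefficients of this dependency annihilate every polynomial of degree at most
[p] on the instants [J].  The first column gives the sum of the coefficients. *)
Lemma curve_tuple_dependent (F : numFieldType) N m r p (C : {set grid N m}) J f x0 :
  uniq J -> size J = p.+2 -> curve_tuple r p C J f ->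
  exists c : 'rV[F]_p.+2, [/\ c != 0, c *m const_mx 1 = (0 : 'M[_]_1)
    & c *m pts_mx F (fun l : 'I_p.+2 => nth x0 f l) = 0].
Proof.
move=> uJ sJ /andP[_ /existsP[q hq]].
pose V : 'M[F]_(p.+2, p.+1) := \matrix_(l, k) (nth 0%N J l)%:R ^+ k.
have /rowV0Pn[c /sub_kermxP cV c0] : kermx V != 0.
  by rewrite kermx_eq0 /row_free neq_ltn ltnS rank_leq_col.
have cVk (k : 'I_p.+1) : \sum_l c 0 l * (nth 0%N J l)%:R ^+ k = 0.
  have := congr1 (fun M : 'M[F]_(1, p.+1) => M 0 k) cV; rewrite !mxE => e; rewrite -[RHS]e.
  by apply: eq_bigr => l _; rewrite mxE.
have c1 : \sum_l c 0 l = 0.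
  by rewrite -[RHS](cVk ord0); apply: eq_bigr => l _; rewrite expr0 mulr1.
have sf : size f = p.+2 by move: hq; rewrite all2E => /andP[/eqP -> _].
have hitl (l : 'I_p.+2) i : (nth x0 f l i + m = curve_eval q i (nth 0 J l))%N.
  move: hq; rewrite all2E => /andP[_ /all_nthP] /(_ (x0, 0%N) l).
  rewrite size_zip sf sJ minnn => /(_ (ltn_ord l)); rewrite nth_zip ?sf//=.
  by move=> /forallP/(_ i)/eqP.
exists c; split => //.
  by apply/matrixP => a b; rewrite !mxE ord1 -[RHS]c1; apply: eq_bigr => l _; rewrite mxE mulr1.
apply/rowP => i; rewrite !mxE.
transitivity (\sum_l c 0 l * ((curve_eval q i (nth 0%N J l))%:R - m%:R)).
  by apply: eq_bigr => l _; rewrite !mxE -hitl natrD addrK.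
under eq_bigr do rewrite mulrBr.
rewrite sumrB -mulr_suml c1 mul0r subr0 /curve_eval.
under eq_bigr do rewrite natrD mulrDr.
rewrite big_split /= -mulr_suml c1 mul0r add0r.
under eq_bigr => l _.
  rewrite /curve_shift natr_sum mulr_sumr.
  under eq_bigr => k _ do rewrite natrM natrX mulrCA.
  over.
rewrite exchange_big big1// => k _.
by rewrite -mulr_sumr (cVk (lift ord0 k)) mulr0.
Qed.

Definition realise (R : realType) (N m d : nat) (P : 'M[R]_(d, N)) (x : grid N m) : 'rV[R]_d :=
  grid_pt R x *m P^T.

Definition separates (R : realType) (N m d : nat) (P : 'M[R]_(d, N)) : Prop :=
  forall x y : grid N m, x != y -> P *m (grid_pt R x)^T != P *m (grid_pt R y)^T.

Lemma realise_inj (R : realType) (N m d : nat) (P : 'M[R]_(d, N)) :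
  separates m P -> injective (@realise R N m d P).
Proof.
move=> P_inj x y /(congr1 trmx); rewrite /realise !trmx_mul !trmxK => e.
by apply/eqP; apply: contraT => /P_inj; rewrite e eqxx.
Qed.

Definition realisation (R : realType) (N m d : nat) (P : 'M[R]_(d, N)) (T : {set grid N m}) :
  {fset 'rV[R]_d} := [fset realise P x | x in T]%fset.

Lemma card_realisation (R : realType) (N m d : nat) (P : 'M[R]_(d, N)) (T : {set grid N m}) :
  separates m P -> #|` realisation P T|%fset = #|T|.
Proof. by move=> P_inj; rewrite card_imfset /=; [rewrite -cardE | exact: realise_inj]. Qed.

(** The equation of a hyperplane through [p.+3] projected points would be a
vanishing combination of the rows of their matrix of homogeneous coordinates. *)
Lemma realisation_almost_general (R : realType) (N m p : nat) (P : 'M[R]_(p.+1, N))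
    (S : {set grid N m}) :
  (forall g : {ffun 'I_p.+3 -> grid N m}, (p.+1 < \rank (pts_mx R g))%N ->
       row_free (col_mx (one_row R p.+3) (P *m (pts_mx R g)^T))) ->
  (forall g : 'I_p.+3 -> grid N m, injective g -> (forall i, g i \in S) ->
     (p.+1 < \rank (pts_mx R g))%N) ->
  forall T : {set grid N m}, T \subset S -> almost_general_position (realisation P T).
Proof.
move=> Pfree Srank T TS Q QT cQ [H /hyperplane_functional[phi [b [phi0 Hphi]]] QH].
have exg (i : 'I_p.+3) : exists x, x \in T /\ nth 0 (enum_fset Q) i = realise P x.
  have : nth 0 (enum_fset Q) i \in Q by apply: mem_nth; rewrite -/(#|` Q|%fset) cQ.
  by move=> /(fsubsetP QT)/imfsetP[x /= xT ->]; exists x.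
have [g Hg] := fin_all_exists exg.
have injg : injective g.
  move=> i j gij; apply/val_inj/eqP.
  have lt (k : 'I_p.+3) : (k < size (enum_fset Q))%N by rewrite -/(#|` Q|%fset) cQ.
  by rewrite -(nth_uniq 0 (lt i) (lt j) (fset_uniq Q)) (Hg i).2 (Hg j).2 gij.
have gS i : g i \in S by rewrite (fintype.subsetP TS)// (Hg i).1.
pose g' : {ffun 'I_p.+3 -> grid N m} := [ffun i => g i].
have pg : pts_mx R g' = pts_mx R g by apply/matrixP => i j; rewrite !mxE ffunE.
have := Pfree g'; rewrite pg => /(_ (Srank g injg gS)) free.
have : row_mx (- b) phi *m col_mx (one_row R p.+3) (P *m (pts_mx R g)^T) = 0.
  rewrite mul_row_col; apply/rowP => i; rewrite [RHS]mxE.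
  have giQ : realise P (g i) \in Q by rewrite -(Hg i).2; apply: mem_nth; rewrite -/(#|` Q|%fset) cQ.
  have e := Hphi _ (QH _ giQ).
  have col_i : col i (phi *m (P *m (pts_mx R g)^T)) = (realise P (g i) *m phi^T)^T.
    by rewrite !colE -!mulmxA -colE -tr_row rowK /realise !trmx_mul !trmxK mulmxA.
  rewrite e in col_i; have /colP/(_ 0) := col_i; rewrite [LHS]mxE [RHS]mxE => e2.
  rewrite mxE e2 mxE big_ord1 !mxE mulr1 ?ord1 addNr//.
rewrite -[0](mul0mx _ (col_mx (one_row R p.+3) (P *m (pts_mx R g)^T))).
move/(row_free_inj free) => /eqP; rewrite row_mx_eq0 => /andP[_ p_eq0].
by rewrite p_eq0 in phi0.
Qed.

(** A tuple of grid points on a curve would give [p.+2] points of [B] on a common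
hyperplane. *)
Lemma general_position_curve_free (R : realType) (N m r p : nat) (P : 'M[R]_(p.+1, N))
    (T : {set grid N m}) (B : {fset 'rV[R]_p.+1}) :
  (0 < N)%N -> (0 < p)%N -> separates m P -> (B `<=` realisation P T)%fset -> general_position B ->
  exists2 A : {set grid N m}, A \subset T /\ #|A| = #|` B|%fset & curve_free r p A.
Proof.
move=> N0 p0 P_inj BT genB; pose A := [set x in T | realise P x \in B]; exists A.
  split; first by apply/fintype.subsetP => x; rewrite inE => /andP[].
  rewrite -(card_realisation _ P_inj); congr (#|` _|%fset); apply/fsetP => y.
  apply/imfsetP/idP => [[x /=]|yB]; first by rewrite inE => /andP[_ xB] ->.
  have /imfsetP[x /= xT yx] := fsubsetP BT y yB.
  by exists x; rewrite //= inE xT -yx.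
move=> J f uJ sJ; apply/negP => fA.
have uf : uniq f := curve_tuple_uniq N0 p0 uJ fA.
have sf : size f = p.+2.
  by move: fA => /andP[_ /existsP[q]]; rewrite all2E => /andP[/eqP -> _].
have x0 : grid N m by case: f sf {fA uf} => // x.
have [c [c0 c1 cf]] := curve_tuple_dependent R x0 uJ sJ fA.
pose y (l : 'I_p.+2) := realise P (nth x0 f l).
have cy : c *m (\matrix_l y l) = 0.
  have -> : \matrix_l y l = pts_mx R (fun l : 'I_p.+2 => nth x0 f l) *m P^T.
    by apply/row_matrixP => l; rewrite row_mul !rowK.
  by rewrite mulmxA cf mul0mx.
have [H hH yH] := dependent_in_hyperplane c0 c1 cy.
apply: (genB [fset realise P x | x in f]%fset).
- apply/fsubsetP => z /imfsetP[x /= xf ->].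
  by have /andP[/allP/(_ x xf) + _] := fA; rewrite /= inE => /andP[].
- rewrite card_imfset /=; last exact: (realise_inj P_inj).
  by rewrite undup_id// sf.
exists H => // z /imfsetP[x /= xf ->].
have := yH (Ordinal (_ : (index x f < p.+2)%N)); rewrite /y /= nth_index//.
by apply; rewrite -sf index_mem.
Qed.

(** * Choice of the parameters *)

Local Close Scope ring_scope.

(** The logarithm is negligible compared to the identity; [l] stands for the
logarithm of [2 * m]. *)
Lemma log_bound c : exists m0, forall m, m0 <= m -> exists2 l, 2 * m <= 2 ^ l & c * l <= m.
Proof.
case: (posnP c) => [->|c0].
  by exists 0 => m _; exists (2 * m); rewrite ?mul0n// ltnW// ltn_expl.
exists (8 * c * c) => m mm; exists (m %/ c); last by rewrite mulnC leq_trunc_div.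
set l := m %/ c.
have l8 : 8 * c <= l by rewrite leq_divRL.
have ml : m < l.+1 * c by apply: ltn_ceil.
have lh : l <= 2 * l./2 + 1 by have := odd_double_half l; case: (odd l); rewrite -muln2; lia.
have h1 : l./2 < 2 ^ l./2 by apply: ltn_expl.
have h2 : 2 ^ l./2 * 2 ^ l./2 <= 2 ^ l.
  by rewrite -expnD leq_exp2l// addnn -[leqRHS]odd_double_half leq_addl.
apply: leq_trans h2; apply: leq_trans (leq_mul h1 h1).
set a := l./2 in lh *.
have a4 : 4 * c <= a.+1 by lia.
have : 2 * m <= 2 * (l.+1 * c) by lia.
move=> h; apply: leq_trans h _.
apply: (@leq_trans (4 * c * a.+1)); last by rewrite leq_mul2r a4 orbT.
nia.
Qed.

(** With [r] minimal such that [q <= m ^ 9], the number [q] is at least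
[m ^ 9 / 2 ^ 9], hence larger than a given multiple of [m ^ 8 * l] once [m] is large. *)
Lemma grid_size b c : 0 < b -> exists q0, forall q, q0 <= q ->
  exists r l, let m := b * r in
  [/\ 0 < r, c <= m, q <= m ^ 9, 2 * m <= 2 ^ l & c * (m ^ 8 * l.+1) <= q].
Proof.
move=> b0; have [k9 k9E] : exists k9, k9 = 2 ^ 9 by exists (2 ^ 9).
have [m0 Hm0] := log_bound (2 * k9 * c).
pose M := m0 + c + b + 2.
exists (M ^ 9) => q qM.
have q0 : 0 < q by apply: leq_trans qM; rewrite expn_gt0 /M addnS.
have ex : exists r, q <= (b * r) ^ 9.
  by exists q; apply: (@leq_trans (b * q)); rewrite ?leq_pmull// -{1}[b * q]expn1 leq_pexp2l// muln_gt0 b0.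
have [r qr rmin] := ex_minnP ex.
pose m := b * r.
have r0 : 0 < r by case: r qr {rmin m} => //; rewrite muln0 leqNgt q0.
have mM : M <= m by rewrite -(@leq_exp2r _ _ 9)//; apply: leq_trans qr.
have [|l ml cl] := Hm0 m; first by rewrite (leq_trans _ mM)// /M -!addnA leq_addr.
exists r, l; split => //; first by rewrite (leq_trans _ mM)// /M; lia.
have r1 : 1 < r.
  rewrite ltnNge; apply/negP => r1; move: mM; have -> : m = b by rewrite /m; nia.
  by rewrite /M; lia.
have small : (b * r.-1) ^ 9 < q.
  rewrite ltnNge; apply/negP => /rmin; lia.
have mq : m ^ 9 <= k9 * q.
  apply: (@leq_trans ((2 * (b * r.-1)) ^ 9)).
    have r2 : r <= 2 * r.-1 by move: r1; clear; case: r => // r; lia.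
    by rewrite leq_exp2r// /m mulnCA leq_mul2l r2 orbT.
  by rewrite expnMn -k9E leq_mul2l (ltnW small) orbT.
have l0 : 0 < l.
  case: l ml {cl} => //; rewrite expn0 leqNgt (leq_trans _ (leq_pmulr 2 _))//.
  by rewrite muln_gt0 b0.
have k90 : 0 < k9 by rewrite k9E expn_gt0.
rewrite -(leq_pmul2l k90); apply: leq_trans mq; rewrite (expnS m 8).
move: (m ^ 8) => x.
apply: (@leq_trans (2 * k9 * c * l * x)); last by rewrite leq_mul2r cl orbT.
have l2 : l.+1 <= 2 * l by rewrite mul2n -addnn -[l.+1]addn1 leq_add2l.
rewrite (_ : k9 * _ = k9 * c * x * l.+1); last by rewrite !mulnA.
rewrite (_ : 2 * k9 * c * l * _ = k9 * c * x * (2 * l)); last first.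
  by rewrite -!mulnA mulnCA; congr (k9 * _); rewrite mulnCA; congr (c * _); rewrite mulnA mulnC.
by rewrite leq_mul2l l2 orbT.
Qed.

Lemma expn_le_pow2 n t l s K N m : 0 < N -> 0 < t ->
  n <= (2 * m) ^ N -> 2 * m <= 2 ^ l ->
  ((2 * n ^ t) ^ s) ^ K <= 2 ^ (N * s * K * (t * l.+1)).
Proof.
move=> N0 t0 nm ml.
have h1 : n <= 2 ^ (l * N) by apply: leq_trans nm _; rewrite expnM; case: (N) => // N'; rewrite leq_exp2r.
have h2 : 2 * n ^ t <= 2 ^ (1 + l * N * t) by rewrite expnD expn1 leq_mul2l /= expnM leq_exp2r.
have h3 : 2 * n ^ t <= 2 ^ (N * (t * l.+1)).
  apply: leq_trans h2 _; rewrite leq_exp2l// mulnS mulnDr.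
  by apply: leq_add; rewrite ?muln_gt0 ?N0// (mulnC t l) mulnCA mulnA.
move: (t * l.+1) h3 => T h3.
rewrite -expnM (_ : N * s * K * T = N * T * (s * K)); last first.
  by rewrite -!mulnA; congr (N * _); rewrite mulnA mulnC.
case: (posnP (s * K)) => [->|sK]; first by rewrite muln0.
by rewrite [leqRHS]expnM leq_exp2r.
Qed.

(** The exponents fit together as follows: with [N = 8 * d] and [q <= m ^ 9], the
expected number of tuples of low rank is [q] times [O(q ^ d.+1 * m ^ (2 * d) / m ^ (2 * N))],
and [9 * d.+1 + 2 * d < 16 * d] as [d >= 2]; the containers number at most
[2 ^ O(m ^ 8 * l)], fewer than [2 ^ q / 4]. *)
Lemma curve_free_sparse_subset (F : numFieldType) (p e : nat) : 0 < p -> 0 < e ->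
  exists n0, forall n, n0 <= n -> exists m r (S : {set grid (8 * p.+1) m}),
  [/\ n <= #|S|,
     forall g : 'I_p.+3 -> grid (8 * p.+1) m, injective g -> (forall i, g i \in S) ->
       p.+1 < \rank (pts_mx F g)
   & forall A : {set grid (8 * p.+1) m}, A \subset S -> curve_free r p A -> e * #|A| <= 2 * n].
Proof.
move=> p0 e0; pose d := p.+1; pose N := 8 * d; pose k := 16 ^ e.
have k0 : 0 < k by rewrite expn_gt0.
pose b := dilation N p k; pose K := (contconst N p k).+1.
have b0 : 0 < b by rewrite /b /dilation /times muln_gt0 p0 expn_gt0 !muln_gt0 k0 expn_gt0.
pose c := N * d * K + 2 + 2 ^ (d + 5).
have [q0 Hq0] := grid_size c b0.
exists (q0 + e) => n nn; pose q := 2 * n.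
have q0q : q0 <= q by rewrite /q; lia.
have [r [l]] := Hq0 q q0q; set m := b * r => -[r0 cm qm ml cq].
have m0 : 0 < m by rewrite muln_gt0 b0.
exists m, r.
have cN : #|grid N m| = m ^ N := card_grid N m.
have t0 : 0 < m ^ 8 by rewrite expn_gt0 m0.
have tn : (m ^ 8) ^ p.+1 = #|grid N m| by rewrite cN -expnM.
have [CC [C1 C2 C3]] := grid_containers k0 p0 r0 t0 tn.
have N0 : 0 < N by [].
have n1 : #|grid N m|.+1 <= (2 * m) ^ N.
  by rewrite cN expnMn; apply: (@leq_trans (2 * m ^ N)); [rewrite mul2n -addnn -addn1 leq_add2l expn_gt0 m0 | rewrite leq_mul2r -{1}[2]expn1 leq_exp2l// orbT].
have eq0 : e <= q by rewrite /q; lia.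
have few : 4 * #|CC| <= 2 ^ q.
  have h := expn_le_pow2 d K N0 t0 n1 ml.
  apply: leq_trans (leq_mul (leqnn 4) (leq_trans C1 h)) _.
  rewrite -[4]/(2 ^ 2) -expnD leq_exp2l//; apply: leq_trans cq.
  apply: (@leq_trans ((N * d * K + 2) * (m ^ 8 * l.+1))); last by rewrite leq_mul2r leq_addr orbT.
  by rewrite mulnDl addnC leq_add2l leq_pmulr// muln_gt0 t0.
have q8 : 8 * q <= #|grid N m|.
  have m8 : 8 <= m.
    apply: leq_trans cm; apply: leq_trans (leq_addl _ _).
    by rewrite -[8]/(2 ^ 3) leq_exp2l// /d; lia.
  rewrite cN; apply: (@leq_trans (m ^ 10)); first by rewrite (expnS m 9) leq_mul.
  by rewrite leq_pexp2l// /N /d; lia.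
have rare : 8 * (q ^ p.+3 * #|low_rank F N m p.+3 d|) <= q * #|grid N m| ^ p.+3.
  have dN : d <= N by rewrite leq_pmull.
  have ds : d <= p.+3 by rewrite /d; lia.
  have := @card_low_rank F N m p.+3 d dN ds m0; rewrite cN.
  have -> : p.+3 - d = 2 by rewrite /d; lia.
  move=> low; apply: leq_trans (leq_mul (leqnn 8) (leq_mul (leqnn _) low)) _.
  have -> : (m ^ N) ^ p.+3 = (m ^ N) ^ d * m ^ (N * 2) by rewrite (expnM m N 2) -expnD addn2.
  rewrite (expnS q); move: ((m ^ N) ^ d) => y.
  have key : 8 * 2 ^ p.+3 * q ^ p.+2 * m ^ (d * 2) <= m ^ (N * 2).
    apply: (@leq_trans (m * m ^ (9 * p.+2) * m ^ (d * 2))).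
      rewrite leq_mul2r; apply/orP; right; apply: leq_mul.
        apply: leq_trans cm; apply: leq_trans (leq_addl _ _).
        by rewrite -[8]/(2 ^ 3) -expnD leq_exp2l// /d; lia.
      by rewrite expnM leq_exp2r.
    by rewrite -{1}[m]expn1 -!expnD leq_pexp2l// /N /d; lia.
  have := leq_mul (leqnn (q * y)) key.
  move: (2 ^ _) (q ^ _) (m ^ _) (m ^ _) => a1 a2 a3 a4.
  have -> : 8 * (q * a2 * (a1 * (y * a4))) = q * y * (8 * a1 * a2 * a4) by ring.
  by rewrite [q * (y * _)]mulnA.
have W0 : 0 < #|grid N m| by rewrite cN expn_gt0 m0.
have small C : C \in CC -> 16 ^ e * #|C| <= #|grid N m| by move/C2/ltnW.
have [S [S1 S2 S3]] := random_subset e0 eq0 W0 small few rare q8.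
exists S; split.
- by rewrite -(leq_pmul2l (_ : 0 < 2)).
- move=> g injg gS; have := S2 g injg gS; rewrite inE -ltnNge.
  by congr (_ < \rank _); apply/matrixP => i j; rewrite !mxE ffunE.
- move=> A AS /C3[C CC' AC]; apply: leq_trans (S3 C CC'); rewrite leq_mul2l.
  by apply/orP; right; apply: subset_leq_card; rewrite finset.subsetI AS.
Qed.

(** * Sets with small subsets in general position *)

Lemma sparse_almost_general_sets (R : realType) (p e : nat) : 0 < p -> 0 < e ->
  exists n0, forall n, n0 <= n -> exists A : {fset 'rV[R]_p.+1},
  [/\ #|` A|%fset = n, almost_general_position A
    & forall B : {fset 'rV[R]_p.+1}, (B `<=` A)%fset -> general_position B -> e * #|` B|%fset <= 2 * n].
Proof.
move=> p0 e0; have [n0 Hn0] := curve_free_sparse_subset R p0 e0.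
exists n0 => n /Hn0[m [r [S [nS Srank Sfree]]]].
have [P [Pinj Pfree]] := generic_projection R (8 * p.+1) m p.+2 (leqnn p.+1).
have {}Pinj x y := Pinj x y isT.
have [T TS cT] : exists2 T : {set grid (8 * p.+1) m}, T \subset S & #|T| = n.
  exists [set x in take n (enum S)].
    by apply/fintype.subsetP => x; rewrite inE => /mem_take; rewrite mem_enum.
  rewrite cardsE (card_uniqP _) ?take_uniq ?enum_uniq// size_take -cardE.
  by case: ltnP => // Sn; apply/eqP; rewrite eqn_leq Sn nS.
exists (realisation P T); split.
- by rewrite card_realisation.
- exact: realisation_almost_general Srank _ TS.
- move=> B BT genB; have [A [AT <-] fA] := general_position_curve_free r (isT : 0 < 8 * p.+1) p0 Pinj BT genB.
  by apply: Sfree fA; apply: fintype.subset_trans AT TS.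
Qed.

Lemma alpha_le (R : realType) (n d e : nat) (A : {fset 'rV[R]_d}) :
  #|` A|%fset = n -> almost_general_position A ->
  (forall B : {fset 'rV[R]_d}, (B `<=` A)%fset -> general_position B -> e * #|` B|%fset <= 2 * n) ->
  e * alpha R n d <= 2 * n.
Proof.
move=> cA agA HA; rewrite /alpha; elim/big_ind: _ => [|x y hx hy|k /asboolP gk].
- by rewrite muln0.
- by rewrite /maxn; case: ifP.
- by have [B [BA <- genB]] := gk A cA agA; apply: HA.
Qed.

Local Open Scope classical_set_scope.
Local Open Scope ring_scope.

Theorem theorem1p1 (R : realType) (d : nat) (hd : (2 <= d)%N) :
  (fun n : nat => (alpha R n d)%:R / n%:R : R) @ \oo --> (0 : R).
Proof.
case: d hd => [//|[//|p]] _.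
apply/cvgrPdist_le => eps eps0.
(* It suffices that alpha / n <= 2 / e. *)
pose e := (Num.truncn (2 / eps)).+1.
have e_eps : 2 / e%:R <= eps.
  by rewrite ler_pdivrMr// -ler_pdivrMl// mulrC ltW// /e truncnS_gt.
have [n0 Hn0] := @sparse_almost_general_sets R p.+1 e isT isT.
near=> n; have n1 : (0 < n)%N by near: n; exists 1%N.
have /Hn0[A [cA agA HA]] : (n0 <= n)%N by near: n; exists n0.
have le := alpha_le cA agA HA.
rewrite sub0r normrN ger0_norm ?divr_ge0//.
apply: le_trans e_eps; rewrite ler_pdivrMr ?ltr0n// mulrAC ler_pdivlMr//.
by rewrite -!natrM ler_nat mulnC.
Unshelve. all: by end_near.
Qed.
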